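(* Let $f_\theta:\mathbb{R}^{n_0}\to\mathbb{R}^{n_D}$, $\theta\in\mathbb{R}^{n_\theta}$, be a deep neural network consisting of fully connected, convolutional, or (softmax) attention layers, whose activation functions are piecewise analytic. Fix any data $((x_i,y_i))_{i=1}^m\subset\mathbb{R}^{n_0}\times\mathbb{R}^{n_D}$ and any analytic loss function $l:\mathbb{R}^{n_D}\times\mathbb{R}^{n_D}\to\mathbb{R}$. For a nonempty set $I\subseteq\{1,\dots,m\}$ put $$L_I(\theta)=\frac{1}{|I|}\sum_{i\in I} l(y_i,f_\theta(x_i)).$$ Then for almost every step-size $\eta>0$ (with respect to Lebesgue measure), for every nonempty $I\subseteq\{1,\dots,m\}$ (the case $I=\{1,\dots,m\}$ being gradient descent and the other cases being stochastic gradient descent on a mini-batch), every (stochastic) gradient descent map $G_\eta$ for $L_I$, that is, every function $G_\eta:\mathbb{R}^{n_\theta}\to\mathbb{R}^{n_\theta}$ with $G_\eta(\theta)=\theta-\eta\nabla L_I(\theta)$ for all $\theta\in D(L_I)$, is non-singular.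
   Context: Measure means Lebesgue measure. A map $G:\mathbb{R}^p\to\mathbb{R}^p$ is non-singular if $G^{-1}(B)$ has measure zero for every set $B$ of measure zero. A function $f:\mathbb{R}\to\mathbb{R}$ is piecewise analytic if there is a strictly increasing sequence of reals $\{x_i\}_{i\in\mathbb{Z}}$ with $x_i\to\pm\infty$ as $i\to\pm\infty$ such that $f$ restricted to each open interval $(x_i,x_{i+1})$ is (real) analytic. A function $f:\mathbb{R}^p\to\mathbb{R}^q$ is analytic almost everywhere (a.e. analytic) if there is an open set $U\subset\mathbb{R}^p$ whose complement has measure zero such that $f|_U$ is analytic. $D(f)$ denotes the largest open set on which $f$ is analytic. Neural networks. A network $f_\theta=f^{(D)}\circ\cdots\circ f^{(1)}$ is a composition of finitely many layers, and $\theta$ collects all the independent parameters of all layers, so that the parameter space is a Euclidean space $\mathbb{R}^{n_\theta}$. Each layer is one of the following. (i) Fully connected layer: $z\mapsto\sigma_d(W_dz+b_d)$ with parameters $W_d\in\mathbb{R}^{n_d\times n_{d-1}}$, $b_d\in\mathbb{R}^{n_d}$, and activation function $\sigma_d:\mathbb{R}\to\mathbb{R}$ applied entry-wise. (ii) Convolutional layer: as a fully connected layer, except that certain prescribed entries of $W_d$ are constrained to be equal to each other; the parameters are the independent entries. (iii) Softmax attention layer: with parameters $W_q,W_k,W_v$ (real matrices of the same shape), it takes a sequence $x_1,\dots,x_n$ of vectors of the same dimension, forms the matrix $X$ with columns $x_1,\dots,x_n$, sets $Q=W_qX$, $K=W_kX$, $V=W_vX$, and outputs the sequence of columns of $\mathrm{Attention}(Q,K,V)=\mathrm{softmax}\!\left(\frac{QK^T}{\sqrt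 n}\right)V$, where softmax is applied independently to every row. When layers of different types are stacked, a sequence of vectors is identified with the vector obtained by concatenation (and conversely). *)

(* Defs.v *)
From HB Require Import structures.
From mathcomp Require Import all_boot all_order all_algebra finmap.
From mathcomp Require Import all_classical all_reals all_analysis.
From mathcomp Require Import summability.

Set Implicit Arguments.
Unset Strict Implicit.
Unset Printing Implicit Defensive.

Import Order.TTheory GRing.Theory Num.Theory.
Import numFieldNormedType.Exports.

Local Open Scope classical_set_scope.
Local Open Scope ring_scope.

(* Euclidean space R^p is the type 'cV[R]_p of column vectors. *)

Section Measure.
Context {R : realType} {p : nat}.
Implicit Types (a b : 'cV[R]_p) (A : set 'cV[R]_p).

Definition box a b : set 'cV[R]_p :=
  [set x | forall i, a i 0 <= x i 0 <= b i 0].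

Definition box_volume a b : R := \prod_i (b i 0 - a i 0).

(* Lebesgue outer measure on R^p. The covering families are indexed by an
   arbitrary set of naturals, so that they may be finite or empty: a box of R^0
   is never empty and has volume 1. *)
Definition lebesgue_outer_measure A : \bar R :=
  ereal_inf [set s | exists (D : set nat) (a b : nat -> 'cV[R]_p),
    [/\ forall k, D k -> forall i, a k i 0 <= b k i 0,
        A `<=` \bigcup_(k in D) box (a k) (b k)
      & s = \esum_(k in D) (box_volume (a k) (b k))%:E]].

Definition measure_zero A : Prop := lebesgue_outer_measure A = 0%E.

Definition non_singular (G : 'cV[R]_p -> 'cV[R]_p) : Prop :=
  forall B, measure_zero B -> measure_zero (G @^-1` B).

End Measure.

Section Analytic.
Context {R : realType}.

Definition monomial p (h : 'cV[R]_p) (alpha : {ffun 'I_p -> nat}) : R :=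
  \prod_i h i 0 ^+ alpha i.

(* Unconditional convergence, over all multi-indices alpha, of the power series
   with coefficients c centred at a. *)
Definition analytic_at p (f : 'cV[R]_p -> R) (a : 'cV[R]_p) : Prop :=
  exists c : {ffun 'I_p -> nat} -> R, \forall x \near a,
    partial_sum (fun alpha => c alpha * monomial (x - a) alpha) @ totally --> f x.

Definition analytic_on p (U : set 'cV[R]_p) (f : 'cV[R]_p -> R) : Prop :=
  forall a, U a -> analytic_at f a.

(* The largest open set on which f is analytic, written D(f). *)
Definition analytic_domain p (f : 'cV[R]_p -> R) : set 'cV[R]_p :=
  \bigcup_(U in [set U | open U /\ analytic_on U f]) U.

Lemma analytic_domain_open p (f : 'cV[R]_p -> R) : open (analytic_domain f).
Proof. by apply: bigcup_open => U []. Qed.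

Lemma analytic_domain_on p (f : 'cV[R]_p -> R) :
  analytic_on (analytic_domain f) f.
Proof. by move=> a [U [_ fU] Ua]; exact: fU. Qed.

Lemma analytic_domain_max p (f : 'cV[R]_p -> R) (U : set 'cV[R]_p) :
  open U -> analytic_on U f -> U `<=` analytic_domain f.
Proof. by move=> oU fU a Ua; exists U. Qed.

Definition analytic2 p q (l : 'cV[R]_p -> 'cV[R]_q -> R) : Prop :=
  analytic_on setT (fun v : 'cV[R]_(p + q) => l (usubmx v) (dsubmx v)).

Definition analytic1_at (f : R -> R) (a : R) : Prop :=
  exists c : nat -> R, \forall x \near a, pseries c (x - a) @ \oo --> f x.

Definition piecewise_analytic (f : R -> R) : Prop :=
  exists x : int -> R,
    [/\ {homo x : i j / i < j},
        x n%:Z @[n --> \oo] --> +oo,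
        x (- n%:Z) @[n --> \oo] --> -oo
      & forall i t, x i < t < x (i + 1) -> analytic1_at f t].

Definition gradient p (f : 'cV[R]_p -> R) (a : 'cV[R]_p) : 'cV[R]_p :=
  \col_j 'D_(delta_mx j 0) f a.

Definition gradient_descent_map p (f : 'cV[R]_p -> R) (eta : R)
    (G : 'cV[R]_p -> 'cV[R]_p) : Prop :=
  forall theta, analytic_domain f theta -> G theta = theta - eta *: gradient f theta.

End Analytic.

(* layer R n m maps R^n to R^m. In a convolutional layer, tie (i, j) is the
   index, among the k independent weights, of the entry (i, j) of the weight
   matrix; surjectivity says that each independent weight occurs. Attention n d d'
   acts on sequences of n vectors of R^d, with d' x d parameter matrices. *)
Inductive layer (R : realType) : nat -> nat -> Type :=
| FullyConnected n m (sigma : R -> R) : layer R n m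
| Convolutional n m k (tie : 'I_m * 'I_n -> 'I_k)
    (tie_surj : forall e, exists ij, tie ij = e) (sigma : R -> R) : layer R n m
| Attention n d d' : layer R (n * d) (n * d').

Section Layers.
Context {R : realType}.

Definition layer_params n m (L : layer R n m) : nat :=
  match L with
  | FullyConnected n m _ => m * n + m
  | Convolutional n m k _ _ _ => k + m
  | Attention n d d' => d' * d + (d' * d + d' * d)
  end.

Definition affine n m (sigma : R -> R) (W : 'M[R]_(m, n)) (b : 'cV[R]_m)
    (z : 'cV[R]_n) : 'cV[R]_m :=
  map_mx sigma (W *m z + b).

Definition softmax_rows m n (A : 'M[R]_(m, n)) : 'M[R]_(m, n) :=
  \matrix_(i, j) (expR (A i j) / \sum_k expR (A i k)).

Definition attention n d (Q K V : 'M[R]_(d, n)) : 'M[R]_(d, n) :=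
  softmax_rows ((Num.sqrt n%:R)^-1 *: (Q *m K^T)) *m V.

(* mxvec is row-major, hence the transpositions: the n columns of X, of size d,
   are concatenated in order. *)
Definition concat_cols d n (X : 'M[R]_(d, n)) : 'cV[R]_(n * d) := (mxvec X^T)^T.
Definition split_cols d n (z : 'cV[R]_(n * d)) : 'M[R]_(d, n) := (vec_mx z^T)^T.

Definition mx_of_col m n (w : 'cV[R]_(m * n)) : 'M[R]_(m, n) := vec_mx w^T.

Definition layer_eval n m (L : layer R n m) :
    'cV[R]_(layer_params L) -> 'cV[R]_n -> 'cV[R]_m :=
  match L in layer _ n m return 'cV[R]_(layer_params L) -> 'cV[R]_n -> 'cV[R]_m with
  | FullyConnected n m sigma => fun theta z =>
      affine sigma (mx_of_col (usubmx theta)) (dsubmx theta) z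
  | Convolutional n m k tie _ sigma => fun theta z =>
      affine sigma (\matrix_(i, j) usubmx theta (tie (i, j)) 0) (dsubmx theta) z
  | Attention n d d' => fun theta z =>
      let X := split_cols z in
      let Wq := mx_of_col (usubmx theta) in
      let Wk := mx_of_col (usubmx (dsubmx theta)) in
      let Wv := mx_of_col (dsubmx (dsubmx theta)) in
      concat_cols (attention (Wq *m X) (Wk *m X) (Wv *m X))
  end.

Definition layer_activation n m (P : (R -> R) -> Prop) (L : layer R n m) : Prop :=
  match L with
  | FullyConnected _ _ sigma => P sigma
  | Convolutional _ _ _ _ _ sigma => P sigma
  | Attention _ _ _ => True
  end.

End Layers.

(* Stack L N applies the layer L first. *)
Inductive network (R : realType) : nat -> nat -> Type :=
| Single n m (L : layer R n m) : network R n m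
| Stack n m q (L : layer R n m) (N : network R m q) : network R n q.

Section Networks.
Context {R : realType}.

Fixpoint network_params n m (N : network R n m) : nat :=
  match N with
  | Single _ _ L => layer_params L
  | Stack _ _ _ L N => layer_params L + network_params N
  end.

Fixpoint network_eval n m (N : network R n m) :
    'cV[R]_(network_params N) -> 'cV[R]_n -> 'cV[R]_m :=
  match N in network _ n m
    return 'cV[R]_(network_params N) -> 'cV[R]_n -> 'cV[R]_m with
  | Single _ _ L => fun theta x => layer_eval (L := L) theta x
  | Stack _ _ _ L N => fun theta x =>
      network_eval (N := N) (dsubmx theta) (layer_eval (L := L) (usubmx theta) x)
  end.

Fixpoint network_activations n m (P : (R -> R) -> Prop) (N : network R n m) : Prop :=
  match N with
  | Single _ _ L => layer_activation P L
  | Stack _ _ _ L N => layer_activation P L /\ network_activations P N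
  end.

Definition batch_loss n0 nD (N : network R n0 nD) m
    (x : 'I_m -> 'cV[R]_n0) (y : 'I_m -> 'cV[R]_nD)
    (l : 'cV[R]_nD -> 'cV[R]_nD -> R) (I : {set 'I_m})
    (theta : 'cV[R]_(network_params N)) : R :=
  #|I|%:R^-1 * \sum_(i in I) l (y i) (network_eval theta (x i)).

End Networks.

(* Main.v *)
Require Import Defs.
From HB Require Import structures.
From mathcomp Require Import all_boot all_order all_algebra finmap.
From mathcomp Require Import all_classical all_reals all_analysis.
From mathcomp Require Import summability ring lra zify.

Set Implicit Arguments.
Unset Strict Implicit.
Unset Printing Implicit Defensive.

Import Order.TTheory GRing.Theory Num.Theory.
Import numFieldNormedType.Exports.

Local Open Scope classical_set_scope.
Local Open Scope ring_scope.

(** Fix a mini-batch and write [f] for its loss and [D] for the analytic domain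
    of [f]. On [D] the derivative of the gradient descent map is
    [1 - eta * H], with [H] the Hessian of [f], and three facts suffice.

    - The complement of [D] is null ([batch_loss_ae_analytic]). A fully connected
      or convolutional layer fails to be analytic only where some preactivation
      [(W z + b) i] hits a breakpoint of the activation function. The bias [b i]
      occurs nowhere else among the layers up to this one, so the preactivation
      has slope one along [b i], and the translates of one level set in this
      direction are disjoint sets of equal measure. There are uncountably many
      of them, hence they are null ([level_set_null]). An attention layer is
      analytic everywhere. Open sets of analyticity with null complement are
      thus pushed through the network by induction ([network_ae_analytic]).

    - For all but countably many [eta], the set of the points of [D] where
      [det (1 - eta * H)] vanishes is null ([countable_degenerate]). For a
      fixed point, this determinant is a polynomial in [eta] with value [1] at
      [0], so each point belongs to finitely many of these sets; and a family of
      measurable sets with this property has countably many members of positive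
      measure ([countable_positive_measure]). This takes the place of Fubini's
      theorem and of the identity theorem for analytic functions, and the same
      lemma yields [level_set_null].

    - Where [det (1 - eta * H)] does not vanish, the gradient descent map [G]
      satisfies [|x - y| <= C |G x - G y|] locally
      ([gradient_descent_expanding]), because the gradient is strictly
      differentiable. Such a map pulls null sets back to null sets
      ([null_preimage_expanding]); countably many neighbourhoods with rational
      data cover [D].

    The calculus of analytic functions rests on one lemma on power series,
    [power_series_sum]: the functions that are sums of power series with
    absolutely summable terms on a fixed ball are closed under absolutely
    convergent sums. Products, compositions and derivatives of power series are
    such sums. *)

#[local] Existing Instance totally_filter.

(** * Unconditional sums *)

Definition sums_to (R : realType) (I : choiceType) (u : I -> R) (s : R) : Prop :=
  partial_sum u @ totally --> s.

(** Absolute summability is always used with an explicit bound: these bounds are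
    the norms of the power series below. *)
Definition abs_sum_le (R : realType) (I : choiceType) (u : I -> R) (M : R) :
  Prop := forall A : {fset I}, \sum_(i <- A) `|u i| <= M.

Section UnconditionalSums.
Context {R : realType}.
Implicit Type I : choiceType.

Lemma sums_toP I (u : I -> R) (s : R) :
  sums_to u s <-> forall e, 0 < e -> exists A : {fset I},
    forall B : {fset I}, (A `<=` B)%fset -> `|s - \sum_(i <- B) u i| < e.
Proof.
have pE B : partial_sum u B = \sum_(i <- B) u i.
  by rewrite /partial_sum (big_seq_fsetE _ B xpredT).
have cE := @cvgrPdist_lt _ R^o _ _ (@totally_filter I) (partial_sum u) s.
split=> [/cE us e /us [A _ AB]|us].
  by exists A => B /AB /=; rewrite pE.
by apply/cE => e /us[A AB]; exists A => // B /AB; rewrite /= pE.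
Qed.

Lemma fset_sum_diff I (v : I -> R) (A B : {fset I}) : (A `<=` B)%fset ->
  \sum_(i <- B) v i = \sum_(i <- A) v i + \sum_(i <- (B `\` A)%fset) v i.
Proof.
move=> AB; rewrite [LHS](big_fsetID _ (mem A)) /=; congr (_ + _).
  congr (\sum_(i <- enum_fset _) _).
  by apply/fsetP => x; rewrite !inE /= andb_idl// => /(fsubsetP AB).
congr (\sum_(i <- enum_fset _) _).
by apply/fsetP => x; rewrite !inE /= andbC.
Qed.

Lemma fset_sum_le I (v : I -> R) (A B : {fset I}) :
  (forall i, 0 <= v i) -> (A `<=` B)%fset ->
  \sum_(i <- A) v i <= \sum_(i <- B) v i.
Proof. by move=> v0 AB; rewrite (fset_sum_diff v AB) lerDl sumr_ge0. Qed.

Lemma abs_sum_le_ge0 I (u : I -> R) M : abs_sum_le u M -> 0 <= M.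
Proof. by move=> /(_ fset0); rewrite big_seq_fset0. Qed.

Lemma abs_sum_le_dom I (u v : I -> R) M :
  (forall i, `|u i| <= `|v i|) -> abs_sum_le v M -> abs_sum_le u M.
Proof. by move=> uv vM A; apply: le_trans (vM A); apply: ler_sum. Qed.

Lemma abs_sum_leZ I (u : I -> R) M a :
  abs_sum_le u M -> abs_sum_le (fun i => a * u i) (`|a| * M).
Proof.
move=> uM A; under eq_bigr do rewrite normrM.
by rewrite -mulr_sumr ler_wpM2l.
Qed.

Lemma abs_sum_leD I (u v : I -> R) M N :
  abs_sum_le u M -> abs_sum_le v N -> abs_sum_le (fun i => u i + v i) (M + N).
Proof.
move=> uM vN A; apply: le_trans (lerD (uM A) (vN A)).
by rewrite -big_split; apply: ler_sum => i _; apply: ler_normD.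
Qed.

Lemma abs_sum_le_term I (u : I -> R) M i : abs_sum_le u M -> `|u i| <= M.
Proof. by move=> /(_ [fset i]%fset); rewrite big_seq_fset1. Qed.

Lemma sums_toD I (u v : I -> R) s t :
  sums_to u s -> sums_to v t -> sums_to (fun i => u i + v i) (s + t).
Proof.
move=> us vt.
have /= := @cvgD _ R^o _ _ (@totally_filter I) _ _ _ _ us vt.
rewrite /sums_to; congr (cvg_to (_ @ totally) _).
by apply/funext => A; rewrite /partial_sum big_split.
Qed.

Lemma sums_toZ I (u : I -> R) s a :
  sums_to u s -> sums_to (fun i => a * u i) (a * s).
Proof.
move=> us.
have /= := @cvgZr_tmp _ R^o _ _ (@totally_filter I) _ _ a us.
rewrite /sums_to; congr (cvg_to (_ @ totally) _).
  by apply/funext => A; rewrite /partial_sum -mulr_sumr; exact: mulrC.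
by rewrite /GRing.scale /= mulrC.
Qed.

Lemma sums_toB I (u v : I -> R) s t :
  sums_to u s -> sums_to v t -> sums_to (fun i => u i - v i) (s - t).
Proof.
move=> us /(@sums_toZ _ _ _ (-1)) vt; move: (sums_toD us vt).
by rewrite mulN1r; congr sums_to; apply/funext => i; rewrite mulN1r.
Qed.

Lemma sums_to_finite I (u : I -> R) (A : {fset I}) :
  (forall i, i \notin A -> u i = 0) -> sums_to u (\sum_(i <- A) u i).
Proof.
move=> uA; apply/sums_toP => e e0; exists A => B AB.
by rewrite (big_fset_incl _ AB) ?subrr ?normr0// => x _ /uA.
Qed.

Lemma sums_to_norm_le I (u : I -> R) s M :
  sums_to u s -> abs_sum_le u M -> `|s| <= M.
Proof.
move=> /sums_toP us uM; apply/ler_addgt0Pr => e e0.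
have [A /(_ A (fsubset_refl _)) sA] := us _ e0.
rewrite -[s](subrK (\sum_(i <- A) u i)) (le_trans (ler_normD _ _))// addrC.
by rewrite lerD ?(ltW sA)// (le_trans (ler_norm_sum _ _ _)).
Qed.

Lemma abs_sum_tail I (u : I -> R) M e : abs_sum_le u M -> 0 < e ->
  exists A : {fset I}, forall B : {fset I}, (A `<=` B)%fset ->
    \sum_(i <- (B `\` A)%fset) `|u i| < e.
Proof.
move=> uM e0; pose S := [set \sum_(i <- A) `|u i| | A in [set: {fset I}]].
have supS : has_sup S.
  split; first by exists (\sum_(i <- fset0) `|u i|), fset0.
  by exists M => _ [A _ <-].
have [_ [A _ <-] supA] := sup_adherent e0 supS.
exists A => B AB; have : \sum_(i <- B) `|u i| <= sup S.
  by apply: ub_le_sup; [exact: supS.2|exists B].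
by rewrite (fset_sum_diff _ AB); lra.
Qed.

Lemma nonneg_sums_to I (u : I -> R) M :
  (forall i, 0 <= u i) -> abs_sum_le u M -> exists s, sums_to u s.
Proof.
move=> u0 uM; pose S := [set \sum_(i <- A) u i | A in [set: {fset I}]].
have supS : has_sup S.
  split; first by exists (\sum_(i <- fset0) u i), fset0.
  exists M => _ [A _ <-]; apply: le_trans (uM A).
  by apply: ler_sum => i _; apply: ler_norm.
exists (sup S); apply/sums_toP => e e0.
have [_ [A _ <-] supA] := sup_adherent e0 supS.
exists A => B AB; have : \sum_(i <- B) u i <= sup S.
  by apply: ub_le_sup; [exact: supS.2|exists B].
have := fset_sum_le u0 AB.
move=> h1 h2; rewrite ger0_norm; lra.
Qed.

Lemma abs_sum_sums_to I (u : I -> R) M :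
  abs_sum_le u M -> exists s, sums_to u s.
Proof.
move=> uM.
have nM : abs_sum_le (fun i => `|u i|) M.
  by apply: abs_sum_le_dom uM => i; rewrite normr_id.
have [s1 us1] : exists s, sums_to (fun i => u i + `|u i|) s.
  apply: nonneg_sums_to (abs_sum_leD uM nM) => i.
  by have := ler_norm (- u i); rewrite normrN; lra.
have [s2 us2] := nonneg_sums_to (fun i => normr_ge0 (u i)) nM.
exists (s1 - s2); move: (sums_toB us1 us2).
by congr sums_to; apply/funext => i; rewrite addrK.
Qed.

(** Unconditional convergence on the line is absolute: beyond a finite set all
    finite sums are small, and they can be split by sign. *)
Lemma sums_to_abs_bounded I (u : I -> R) s :
  sums_to u s -> exists M, abs_sum_le u M.
Proof.
move=> /sums_toP /(_ 1 ltr01)[A As].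
have small (G : {fset I}) : [disjoint A & G]%fset -> `|\sum_(i <- G) u i| <= 2.
  move=> AG; have AAG := fsubsetUl A G.
  have := As _ AAG; have := As _ (fsubset_refl A).
  rewrite (fset_sum_diff u AAG) fsetDUl fsetDv fset0U.
  have -> : (G `\` A)%fset = G.
    by apply/fsetDidPl; rewrite fdisjoint_sym.
  set x := \sum_(i <- A) _; set y := \sum_(i <- G) _ => h1 h2.
  have -> : y = (s - x) - (s - (x + y)) by lra.
  by rewrite (le_trans (ler_normB _ _))// -[leRHS]/(1 + 1) lerD// ltW.
exists (\sum_(i <- A) `|u i| + (2 + 2)) => B.
have /le_trans -> // := fset_sum_le (fun i => normr_ge0 (u i)) (fsubsetUl B A).
rewrite (fset_sum_diff _ (fsubsetUr B A)) lerD2l.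
set C := (_ `\` _)%fset.
have AC (P : pred I) : [disjoint A & [fset i in C | P i]]%fset.
  apply/fdisjointP => i iA; rewrite !inE iA /=.
  by [].
rewrite (big_fsetID _ (fun i => 0 <= u i)) /= lerD//.
  apply: le_trans (small _ (AC (fun i => 0 <= u i))).
  apply: le_trans (ler_norm _); rewrite big_seq [leRHS]big_seq.
  apply: ler_sum => i; rewrite !inE => /andP[_ ui].
  by rewrite ger0_norm.
apply: le_trans (small _ (AC (fun i => ~~ (0 <= u i)))).
rewrite -normrN; apply: le_trans (ler_norm _).
rewrite -sumrN big_seq [leRHS]big_seq.
apply: ler_sum => i; rewrite !inE => /andP[_].
by rewrite -ltNge => ui; rewrite ltr0_norm.
Qed.

Lemma nat_sums_to (u : nat -> R) M s :
  abs_sum_le u M -> series u @ \oo --> s -> sums_to u s.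
Proof.
move=> uM us; have [t ut] := abs_sum_sums_to uM.
suff -> : s = t by [].
apply: (cvg_unique _ us) => //.
apply/cvgrPdist_lt => e e0; move/sums_toP : (ut) => /(_ _ e0)[A As].
exists (\max_(i <- A) i).+1 => //= n /= An.
have -> : series u n = \sum_(i <- [fset i in iota 0 n]%fset) u i.
  rewrite /series /= big_imfset //= /index_iota subn0.
  by rewrite undup_id ?iota_uniq.
apply: As; apply/fsubsetP => i iA; rewrite !inE mem_iota /= add0n.
by apply: leq_ltn_trans An; apply: leq_bigmax_seq.
Qed.

End UnconditionalSums.

Section Fubini.
Context {R : realType}.
Implicit Types I J K : choiceType.

Lemma sums_to_sum (T : Type) K (c : T -> K -> R) (g : T -> R) (r : seq T) :
  (forall b, sums_to (c b) (g b)) ->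
  sums_to (fun k => \sum_(b <- r) c b k) (\sum_(b <- r) g b).
Proof.
move=> cg; elim: r => [|b r IH].
  rewrite big_nil; have := @sums_to_finite R K (fun=> 0) fset0 (fun _ _ => erefl).
  by rewrite big1//; congr sums_to; apply/funext => k; rewrite big_nil.
rewrite big_cons; move: (sums_toD (cg b) IH).
by congr sums_to; apply/funext => k; rewrite big_cons.
Qed.

(** The signs of the column sums turn their absolute values into one sum over
    the rows, which the row bounds control. *)
Lemma abs_sum_le_columns J K (c : J -> K -> R) (N : J -> R) M (C : K -> R) :
  (forall b, abs_sum_le (c b) (N b)) -> abs_sum_le N M ->
  (forall k, sums_to (c^~ k) (C k)) -> abs_sum_le C M.
Proof.
move=> cN NM cC A.
have -> : \sum_(k <- A) `|C k| = \sum_(k <- A) Num.sg (C k) * C k.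
  by apply: eq_bigr => k _; rewrite normrEsg.
apply: le_trans (ler_norm _) _.
apply: (@sums_to_norm_le _ _ (fun b => \sum_(k <- A) Num.sg (C k) * c b k)).
  by apply: sums_to_sum => k; apply: sums_toZ.
apply: abs_sum_le_dom NM => b; apply: le_trans (ler_norm_sum _ _ _) _.
apply: le_trans (ler_norm _); apply: le_trans (cN b A).
apply: ler_sum => k _; rewrite normrM ler_piMl//.
by rewrite normr_sg; case: (_ != _).
Qed.

(** Removing finitely many terms removes their sum; zeros keep the index type. *)
Lemma sums_to_mask J (u : J -> R) s (E : {fset J}) : sums_to u s ->
  sums_to (fun j => if j \in E then 0 else u j) (s - \sum_(j <- E) u j).
Proof.
move=> us.
have uE : sums_to (fun j => if j \in E then u j else 0) (\sum_(j <- E) u j).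
  rewrite big_seq (eq_bigr (fun j => if j \in E then u j else 0)); last first.
    by move=> j ->.
  by rewrite -big_seq; apply: sums_to_finite => j /negbTE ->.
move: (sums_toB us uE); congr sums_to; apply/funext => j.
by case: ifP; rewrite ?subrr ?subr0.
Qed.

(** Fubini for absolutely convergent double families. Truncating the rows to
    the complement of a finite set makes the row bounds add up to less than
    any given [e], and [abs_sum_le_columns] bounds what is left. *)
Lemma sums_to_columns J K (c : J -> K -> R) (N : J -> R) M (g : J -> R) s
    (C : K -> R) :
  (forall b, abs_sum_le (c b) (N b)) -> abs_sum_le N M ->
  (forall b, sums_to (c b) (g b)) -> sums_to g s ->
  (forall k, sums_to (c^~ k) (C k)) -> sums_to C s.
Proof.
move=> cN NM cg gs cC.
have [t Ct] := abs_sum_sums_to (abs_sum_le_columns cN NM cC).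
suff -> : s = t by [].
apply/eqP; rewrite -subr_eq0 -normr_le0; apply/ler_addgt0Pr => e e0.
rewrite add0r [e]splitr; have e20 : 0 < e / 2 by lra.
have [E1 tailE] := abs_sum_tail NM e20.
have [E2 gE] := (sums_toP g s).1 gs _ e20.
pose E := (E1 `|` E2)%fset.
rewrite -[s](subrK (\sum_(b <- E) g b)) -addrA (le_trans (ler_normD _ _))//.
apply: lerD; first by rewrite ltW// gE// fsubsetUr.
rewrite distrC.
apply: (@sums_to_norm_le _ _ (fun k => C k - \sum_(b <- E) c b k)).
  by apply: sums_toB => //; apply: sums_to_sum.
apply: (@abs_sum_le_columns J _ (fun b k => if b \in E then 0 else c b k)
  (fun b => if b \in E then 0 else N b)).
- move=> b A; case: ifP => _; last exact: cN.
  by rewrite big1// => k _; rewrite normr0.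
- move=> A; apply: le_trans (ltW (tailE (A `|` E1)%fset (fsubsetUr _ _))).
  have := fset_sum_le (fun b => normr_ge0 (if b \in E then 0 else N b))
    (fsubsetUl A E1).
  move/le_trans; apply; rewrite (fset_sum_diff _ (fsubsetUr A E1)).
  rewrite big_seq big1 ?add0r => [|b bE]; last first.
    by rewrite inE bE normr0.
  by apply: ler_sum => b _; case: ifP; rewrite ?normr0.
- by move=> k; exact: (sums_to_mask (E := E) (cC k)).
Qed.

End Fubini.

(** * Power series *)

Section PowerSeries.
Context {R : realType} {p : nat}.
Local Notation index := {ffun 'I_p -> nat}.
Implicit Types (a h k : 'cV[R]_p) (f g : 'cV[R]_p -> R) (alpha beta : index).

Definition mdeg alpha : nat := \sum_i alpha i.

(** [f] is the sum near [a] of a power series whose terms are absolutely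
    summable, with sum at most [M], on the closed sup-norm ball of radius [r]:
    the elements of norm at most [M] of a Banach algebra. *)
Definition power_series_at a (r M : R) f : Prop :=
  exists c : index -> R, abs_sum_le (fun alpha => c alpha * r ^+ mdeg alpha) M /\
    forall h, `|h| <= r ->
      sums_to (fun alpha => c alpha * monomial h alpha) (f (a + h)).

Lemma coord_le_norm h i : `|h i 0| <= `|h|.
Proof.
rewrite [leRHS]/Num.norm /= mx_normrE.
by rewrite (le_trans _ (le_bigmax _ _ (i, 0))).
Qed.

Lemma norm_le_coord h r : 0 <= r -> (forall i, `|h i 0| <= r) -> `|h| <= r.
Proof.
move=> r0 hr; rewrite [leLHS]/Num.norm /= mx_normrE.
by apply: bigmax_le => // -[i j] _ /=; rewrite (ord1 j).
Qed.

Lemma monomial_const (r : R) alpha : monomial (const_mx r) alpha = r ^+ mdeg alpha.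
Proof.
rewrite /monomial /mdeg; under eq_bigr do rewrite mxE.
by rewrite prodrXr.
Qed.

Lemma monomial_le h alpha r : `|h| <= r -> `|monomial h alpha| <= r ^+ mdeg alpha.
Proof.
move=> hr; rewrite -monomial_const normr_prod; apply: ler_prod => i _.
rewrite normr_ge0 normrX mxE lerXn2r ?nnegrE//.
  by rewrite (le_trans _ hr).
by rewrite (le_trans (coord_le_norm _ _)).
Qed.

(** Summing the coefficients of the summands one by one is legitimate by
    [sums_to_columns], applied with the monomials as weights. *)
Lemma power_series_sum (J : choiceType) (g : J -> 'cV[R]_p -> R) (N : J -> R)
    a r M f : 0 < r ->
  (forall j, power_series_at a r (N j) (g j)) -> abs_sum_le N M ->
  (forall h, `|h| <= r -> sums_to (fun j => g j (a + h)) (f (a + h))) ->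
  power_series_at a r M f.
Proof.
move=> r0 /choice[c cP] NM gf.
have rX alpha : 0 < r ^+ mdeg alpha by rewrite exprn_gt0.
have cb alpha : abs_sum_le (fun j => c j alpha) (`|(r ^+ mdeg alpha)^-1| * M).
  have -> : (fun j => c j alpha) =
      (fun j => (r ^+ mdeg alpha)^-1 * (c j alpha * r ^+ mdeg alpha)).
    by apply/funext => j; rewrite mulrCA mulVf ?mulr1// gt_eqF.
  apply: abs_sum_leZ; apply: abs_sum_le_dom NM => j.
  exact: le_trans (abs_sum_le_term alpha (cP j).1) (ler_norm _).
have [C CP] := choice (fun alpha => abs_sum_sums_to (cb alpha)).
exists C; split=> [|h hr].
  apply: (abs_sum_le_columns (fun j => (cP j).1) NM) => alpha.
  under eq_fun do rewrite mulrC; rewrite mulrC.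
  exact: sums_toZ.
have hb j : abs_sum_le (fun alpha => c j alpha * monomial h alpha) (N j).
  apply: abs_sum_le_dom (cP j).1 => alpha.
  by rewrite !normrM ler_wpM2l// [leRHS]gtr0_norm//; exact: monomial_le.
apply: (sums_to_columns hb NM (fun j => (cP j).2 h hr) (gf h hr)) => alpha.
by under eq_fun do rewrite mulrC; rewrite mulrC; exact: sums_toZ.
Qed.

End PowerSeries.

Section PowerSeriesAlgebra.
Context {R : realType} {p : nat}.
Local Notation index := {ffun 'I_p -> nat}.
Implicit Types (a h : 'cV[R]_p) (f g : 'cV[R]_p -> R) (alpha beta : index).

Lemma power_series_ext a r M f g : (forall h, `|h| <= r -> f (a + h) = g (a + h)) ->
  power_series_at a r M f -> power_series_at a r M g.
Proof.
by move=> fg [c [cM cf]]; exists c; split=> // h hr; rewrite -fg//; exact: cf.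
Qed.

Lemma power_series_le a r M r' M' f : 0 <= r' -> r' <= r -> M <= M' ->
  power_series_at a r M f -> power_series_at a r' M' f.
Proof.
move=> r'0 r'r MM' [c [cM cf]]; exists c; split=> [A|h hr].
  apply: le_trans (le_trans (cM A) MM'); apply: ler_sum => alpha _.
  by rewrite !normrM ler_wpM2l// !normrX lerXn2r ?nnegrE// !ger0_norm// (le_trans r'0).
exact/cf/(le_trans hr).
Qed.

Lemma power_series_bound a r M f h :
  power_series_at a r M f -> `|h| <= r -> `|f (a + h)| <= M.
Proof.
move=> [c [cM cf]] hr; apply: sums_to_norm_le (cf h hr) _.
apply: abs_sum_le_dom cM => alpha; rewrite !normrM ler_wpM2l//.
by rewrite [leRHS]ger0_norm ?exprn_ge0 ?(le_trans _ hr)//; exact: monomial_le.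
Qed.

Lemma power_series_monomial a r k beta f : 0 <= r ->
  (forall h, `|h| <= r -> f (a + h) = k * monomial h beta) ->
  power_series_at a r (`|k| * r ^+ mdeg beta) f.
Proof.
move=> r0 fE; exists (fun alpha => if alpha == beta then k else 0); split=> [A|h hr].
  have r'0 : 0 <= `|k| * r ^+ mdeg beta by rewrite mulr_ge0// exprn_ge0.
  case: (boolP (beta \in A)) => bA.
    rewrite (big_fsetD1 beta)//= eqxx normrM [ `|r ^+ _|]ger0_norm ?exprn_ge0//.
    rewrite big_seq big1 ?addr0// => alpha; rewrite !inE => /andP[/negbTE -> _].
    by rewrite mul0r normr0.
  rewrite big_seq big1// => alpha alphaA; case: eqP => [ab|]; last first.
    by rewrite mul0r normr0.
  by rewrite -ab alphaA in bA.
rewrite fE//; have := @sums_to_finite _ _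
  (fun alpha => (if alpha == beta then k else 0) * monomial h alpha) [fset beta]%fset.
rewrite big_seq_fset1 eqxx; apply=> i; rewrite inE => /negbTE ->.
by rewrite mul0r.
Qed.

Lemma power_series_const a r k : 0 <= r -> power_series_at a r `|k| (fun=> k).
Proof.
move=> r0; have d0 : mdeg ([ffun=> 0%N] : index) = 0%N.
  by rewrite /mdeg big1// => i _; rewrite ffunE.
have := @power_series_monomial a r k [ffun=> 0%N] (fun=> k) r0.
rewrite d0 mulr1; apply=> h _; rewrite /monomial big1 ?mulr1// => i _.
by rewrite ffunE.
Qed.

Lemma power_series_coord a r i : 0 <= r ->
  power_series_at a r r (fun x => x i 0 - a i 0).
Proof.
move=> r0; pose beta : index := [ffun j => nat_of_bool (j == i)].
have d1 : mdeg beta = 1%N.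
  rewrite /mdeg (bigD1 i)//= ffunE eqxx big1// => j /negbTE ji.
  by rewrite ffunE ji.
have := @power_series_monomial a r 1 beta (fun x => x i 0 - a i 0) r0.
rewrite d1 expr1 normr1 mul1r; apply=> h _; rewrite mul1r /monomial (bigD1 i)//=.
rewrite ffunE eqxx expr1 big1 ?mulr1; first by rewrite !mxE; ring.
by move=> j /negbTE ji; rewrite ffunE ji.
Qed.

Lemma power_seriesZ a r M k f : power_series_at a r M f ->
  power_series_at a r (`|k| * M) (fun x => k * f x).
Proof.
move=> [c [cM cf]]; exists (fun alpha => k * c alpha); split=> [|h hr].
  by under eq_fun do rewrite -mulrA; exact: abs_sum_leZ.
by under eq_fun do rewrite -mulrA; exact/sums_toZ/cf.
Qed.

Lemma power_seriesD a r M N f g : power_series_at a r M f ->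
  power_series_at a r N g -> power_series_at a r (M + N) (fun x => f x + g x).
Proof.
move=> [c [cM cf]] [d [dN dg]]; exists (fun alpha => c alpha + d alpha).
split=> [|h hr].
  by under eq_fun do rewrite mulrDl; exact: abs_sum_leD.
by under eq_fun do rewrite mulrDl; apply: sums_toD; [exact: cf|exact: dg].
Qed.

Lemma power_series_mul_monomial a r M f g k beta : 0 < r ->
  power_series_at a r M f ->
  (forall h, `|h| <= r -> g (a + h) = k * monomial h beta * f (a + h)) ->
  power_series_at a r (`|k| * r ^+ mdeg beta * M) g.
Proof.
move=> r0 [c [cM cf]] gE.
have rb0 : 0 <= r ^+ mdeg beta by rewrite exprn_ge0// ltW.
apply: (@power_series_sum _ _ _
  (fun alpha x => k * c alpha * monomial (x - a) [ffun i => alpha i + beta i]%N)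
  (fun alpha => (`|k| * r ^+ mdeg beta) * `|c alpha * r ^+ mdeg alpha|)) => //.
- move=> alpha; have -> : `|k| * r ^+ mdeg beta * `|c alpha * r ^+ mdeg alpha| =
    `|k * c alpha| * r ^+ mdeg [ffun i => alpha i + beta i]%N.
    have -> : mdeg [ffun i => alpha i + beta i]%N = (mdeg alpha + mdeg beta)%N.
      by rewrite /mdeg -big_split; apply: eq_bigr => i _; rewrite ffunE.
    by rewrite !normrM exprD [ `|r ^+ _|]ger0_norm ?exprn_ge0 ?ltW//; ring.
  by apply: power_series_monomial (ltW r0) _ => h _; rewrite addrC addKr.
- have -> : `|k| * r ^+ mdeg beta * M = `| `|k| * r ^+ mdeg beta| * M.
    by rewrite [in RHS]ger0_norm// mulr_ge0.
  by apply: abs_sum_leZ => A; under eq_bigr do rewrite normr_id.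
- move=> h hr; rewrite gE//.
  have -> : (fun alpha => k * c alpha *
     monomial (a + h - a) [ffun i => alpha i + beta i]%N) =
     fun alpha => k * monomial h beta * (c alpha * monomial h alpha).
    apply/funext => alpha; rewrite addrC addKr.
    have -> : monomial h [ffun i => alpha i + beta i]%N =
        monomial h alpha * monomial h beta.
      by rewrite /monomial -big_split; apply: eq_bigr => i _; rewrite ffunE exprD.
    by ring.
  exact/sums_toZ/cf.
Qed.

(** A product is the sum over the terms of [f] of their products with [g], each
    of which only shifts the exponents of [g]. *)
Lemma power_seriesM a r M N f g : 0 < r -> power_series_at a r M f ->
  power_series_at a r N g -> power_series_at a r (M * N) (fun x => f x * g x).
Proof.
move=> r0 [c [cM cf]] gN; have [d [dN _]] := gN.
apply: (@power_series_sum _ _ _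
  (fun alpha x => c alpha * monomial (x - a) alpha * g x)
  (fun alpha => `|c alpha| * r ^+ mdeg alpha * N)) => //.
- move=> alpha; apply: (power_series_mul_monomial r0 gN) => h _.
  by rewrite addrC addKr.
- move=> A; under eq_bigr do rewrite normrM [ `|N|]ger0_norm ?(abs_sum_le_ge0 dN)//.
  rewrite -mulr_suml ler_wpM2r ?(abs_sum_le_ge0 dN)//.
  apply: le_trans (cM A); apply: ler_sum => alpha _.
  by rewrite !normrM normr_id.
- move=> h hr; under eq_fun do rewrite mulrC; rewrite mulrC.
  by apply: sums_toZ; under eq_fun do rewrite addrC addKr; exact: cf.
Qed.

Lemma power_seriesX a r M f n : 0 < r -> power_series_at a r M f ->
  power_series_at a r (M ^+ n) (fun x => f x ^+ n).
Proof.
move=> r0 fM; elim: n => [|n IH].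
  have := power_series_const a 1 (ltW r0); rewrite normr1 expr0.
  exact: power_series_ext.
rewrite exprS; apply: power_series_ext (power_seriesM r0 fM IH) => h _.
by rewrite exprS.
Qed.

Lemma power_series_prod (I : Type) (s : seq I) a r (M : I -> R)
    (f : I -> 'cV[R]_p -> R) : 0 < r ->
  (forall i, power_series_at a r (M i) (f i)) ->
  power_series_at a r (\prod_(i <- s) M i) (fun x => \prod_(i <- s) f i x).
Proof.
move=> r0 fM; elim: s => [|i s IH].
  rewrite big_nil; have := power_series_const a 1 (ltW r0); rewrite normr1.
  by apply: power_series_ext => h _; rewrite big_nil.
rewrite big_cons; apply: power_series_ext (power_seriesM r0 (fM i) IH) => h _.
by rewrite big_cons.
Qed.

(** The inner functions are bounded on their ball by the radius [s] of the outer
    series, so each term of the outer series has norm at most its own absolute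
    value at radius [s]. *)
Lemma power_series_comp q (F : 'cV[R]_p -> 'cV[R]_q) a (b : 'cV[R]_q) r s M
    (g : 'cV[R]_q -> R) : 0 < r -> 0 <= s -> power_series_at b s M g ->
  (forall j, power_series_at a r s (fun x => F x j 0 - b j 0)) ->
  power_series_at a r M (g \o F).
Proof.
move=> r0 s0 [d [dM dg]] Fs.
apply: (@power_series_sum _ _ _
  (fun (beta : {ffun 'I_q -> nat}) x => d beta * monomial (F x - b) beta)
  (fun (beta : {ffun 'I_q -> nat}) => `|d beta| * s ^+ mdeg beta)) => //.
- move=> beta; apply: power_seriesZ.
  rewrite /mdeg -prodrXr /monomial.
  apply: (@power_series_ext a r _ (fun x =>
    \prod_(i <- index_enum 'I_q) (F x i 0 - b i 0) ^+ beta i)).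
    by move=> h hr; apply: eq_bigr => i _; rewrite !mxE.
  by apply: power_series_prod => // i; apply: power_seriesX.
- by apply: abs_sum_le_dom dM => beta; rewrite !normrM normr_id.
- move=> h hr.
  have Fb : `|F (a + h) - b| <= s.
    apply: norm_le_coord => // i; rewrite !mxE.
    exact: (power_series_bound (Fs i) hr).
  by have := dg _ Fb; rewrite /= [b + _]addrC subrK.
Qed.

Lemma power_series_comp1 (F : 'cV[R]_p -> R) a (b : R) r s M
    (d : nat -> R) (g : R -> R) : 0 < r -> 0 <= s ->
  abs_sum_le (fun n => d n * s ^+ n) M ->
  (forall t, `|t| <= s -> sums_to (fun n => d n * t ^+ n) (g (b + t))) ->
  power_series_at a r s (fun x => F x - b) ->
  power_series_at a r M (g \o F).
Proof.
move=> r0 s0 dM dg Fs.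
apply: (@power_series_sum _ _ _ (fun n x => d n * (F x - b) ^+ n)
  (fun n => `|d n| * s ^+ n)) => //.
- by move=> n; apply/power_seriesZ/power_seriesX.
- by apply: abs_sum_le_dom dM => n; rewrite !normrM normr_id.
- move=> h hr; have := dg _ (power_series_bound Fs hr).
  by rewrite /= [b + _]addrC subrK.
Qed.

Lemma monomial0 alpha : monomial (0 : 'cV[R]_p) alpha = (mdeg alpha == 0%N)%:R.
Proof.
by rewrite -(_ : const_mx 0 = 0) ?monomial_const ?expr0n//; apply/matrixP => i j; rewrite !mxE.
Qed.

(** The value at the centre is the only term of degree zero, so removing it
    makes the norm of a power series tend to zero with the radius. *)
Lemma power_series_shrink a r M f : 0 < r -> power_series_at a r M f ->
  forall s, 0 < s -> exists2 r', 0 < r' <= r &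
    power_series_at a r' s (fun x => f x - f a).
Proof.
move=> r0 [c [cM cf]] s s0; have M0 := abs_sum_le_ge0 cM.
(* Shrinking by a factor q <= 1 with q * M <= s multiplies each term of positive
   degree by at most q. *)
pose r' := r * (s / (s + M)).
have sM : 0 < s + M by lra.
have q0 : 0 < s / (s + M) by rewrite divr_gt0.
have q1 : s / (s + M) <= 1 by rewrite ler_pdivrMr//; lra.
exists r'; first by rewrite mulr_gt0//= ler_piMr// ltW.
have := cf 0; rewrite addr0 normr0 => /(_ (ltW r0)) fa.
have deg0 : sums_to (fun alpha => if mdeg alpha == 0%N then c alpha else 0) (f a).
  move: fa; congr sums_to; apply/funext => alpha.
  by rewrite monomial0; case: eqP; rewrite ?mulr1 ?mulr0.
exists (fun alpha => if mdeg alpha == 0%N then 0 else c alpha); split=> [A|h hr].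
  apply: (@le_trans _ _ (s / (s + M) * M)); last first.
    by rewrite mulrAC ler_pdivrMr// ler_wpM2l//; lra.
  apply: le_trans (ler_wpM2l (ltW q0) (cM A)).
  rewrite mulr_sumr; apply: ler_sum => alpha _.
  case: eqP => [_|/eqP d0]; first by rewrite mul0r normr0 mulr_ge0// ltW.
  have rX0 : 0 <= r ^+ mdeg alpha by rewrite exprn_ge0// ltW.
  have qX0 : 0 <= (s / (s + M)) ^+ mdeg alpha by rewrite exprn_ge0// ltW.
  rewrite !normrM mulrCA ler_wpM2l// /r' exprMn normrM !ger0_norm// mulrC.
  by rewrite ler_wpM2r// -[leRHS]expr1 ler_wiXn2l// ?(ltW q0)// lt0n.
have hr1 : `|h| <= r by rewrite (le_trans hr)// ler_piMr// ltW.
move: (sums_toB (cf h hr1) deg0); congr sums_to; apply/funext => alpha.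
case: eqP => [d0|]; last by rewrite subr0.
rewrite mul0r /monomial big1 ?mulr1 ?subrr// => i _.
suff -> : alpha i = 0%N by rewrite expr0.
by apply/eqP; rewrite -leqn0 -d0 /mdeg (bigD1 i)//= leq_addr.
Qed.

End PowerSeriesAlgebra.

(** * Differentiation of power series *)

Section Differentiation.
Context {R : realType} {p : nat}.
Local Notation index := {ffun 'I_p -> nat}.
Implicit Types (a h v : 'cV[R]_p) (f g : 'cV[R]_p -> R) (alpha beta : index).

Definition coord_vec (j : 'I_p) : 'cV[R]_p := delta_mx j 0.

Lemma coord_vecE j i : coord_vec j i 0 = (i == j)%:R.
Proof. by rewrite mxE eqxx andbT. Qed.

Lemma coord_vec_norm_le j : `|coord_vec j| <= 1.
Proof.
by apply: norm_le_coord => // i; rewrite coord_vecE; case: eqP; rewrite ?normr0 ?normr1.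
Qed.

(** A quadratic bound on the remainder of the increments along one axis
    determines the partial derivative. *)
Lemma partial_derivative_eq f a j l K d : 0 < d ->
  (forall t, `|t| <= d ->
    `|f (a + t *: coord_vec j) - f a - l * t| <= K * `|t| ^+ 2) ->
  'D_(coord_vec j) f a = l.
Proof.
move=> d0 fl; rewrite /derive.
apply: (@cvg_lim R^o); first exact: norm_hausdorff.
apply/cvgrPdist_lt => e e0.
have K0 : 0 <= K.
  have dd : `|d| <= d by rewrite gtr0_norm.
  have := le_trans (normr_ge0 _) (fl d dd).
  by rewrite pmulr_lge0// exprn_gt0// normr_gt0 gt_eqF.
have m0 : 0 < Num.min d (e / (K + 1)).
  by rewrite lt_min d0 divr_gt0// ltr_wpDl.
near=> t.
have t0 : t != 0 by near: t; exact: nbhs_dnbhs_neq.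
have tm : `|t| < Num.min d (e / (K + 1)).
  near: t; apply: dnbhs0_lt => //.
move: tm; rewrite lt_min => /andP[/ltW td te].
have := fl t td; rewrite /= [t *: _ + a]addrC.
set y := f (_ + _) - f a => hy.
have -> : l - t^-1 *: y = - (t^-1 * (y - l * t)).
  by rewrite mulrBr [t^-1 * (l * t)]mulrCA mulVf// mulr1 opprB.
rewrite normrN normrM normfV.
apply: (@le_lt_trans _ _ (`|t|^-1 * (K * `|t| ^+ 2))); first by rewrite ler_wpM2l.
rewrite mulrCA expr2 mulKf ?normr_eq0//.
apply: (@le_lt_trans _ _ ((K + 1) * `|t|)); first by rewrite ler_wpM2r// lerDl.
by rewrite mulrC -ltr_pdivlMr// ltr_wpDl.
Unshelve. all: by end_near. Qed.

(** Multiplying by [s ^+ 2] instead of using the exponent [n - 2] makes the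
    estimate hold for all [n], by induction. *)
Lemma exp_remainder_le (s x t : R) n : `|x| <= s -> `|x + t| <= s ->
  s ^+ 2 * `|(x + t) ^+ n - x ^+ n - (n%:R * x ^+ n.-1) * t|
    <= `|t| ^+ 2 * (n ^ 2)%:R * s ^+ n.
Proof.
move=> xs xts; have s0 : 0 <= s by rewrite (le_trans _ xs).
elim: n => [|n IH].
  by rewrite !expr0 subrr mul0r mul0r subr0 normr0 mulr0 !mulr_ge0.
set E := (x + t) ^+ n - x ^+ n - _ in IH.
have -> : (x + t) ^+ n.+1 - x ^+ n.+1 - n.+1%:R * x ^+ n.+1.-1 * t =
   (x + t) * E + (n%:R * x ^+ n.-1) * t ^+ 2.
  rewrite /E; case: n {IH E} => [|n] /=; first by rewrite expr0 expr1; ring.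
  by rewrite !exprS -natr1 -[n.+1%:R]natr1; ring.
apply: (@le_trans _ _ (s * (`|t| ^+ 2 * (n ^ 2)%:R * s ^+ n) +
   n%:R * s ^+ n.+1 * `|t| ^+ 2)).
  apply: le_trans (ler_wpM2l (exprn_ge0 _ s0) (ler_normD _ _)) _.
  rewrite mulrDr lerD//.
    by rewrite normrM mulrCA ler_pM// mulr_ge0// exprn_ge0.
  rewrite !normrM normrX [ `|n%:R|]ger0_norm// mulrA ler_wpM2r ?exprn_ge0//.
  rewrite mulrCA; case: n {IH E} => [|n]; first by rewrite !mul0r.
  rewrite ler_wpM2l//= -[n.+2]/(2 + n)%N exprD.
  by rewrite ler_wpM2l ?exprn_ge0// lerXn2r ?nnegrE.
rewrite [leLHS](_ : _ = `|t| ^+ 2 * (n ^ 2 + n)%:R * s ^+ n.+1).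
  rewrite ler_wpM2r ?exprn_ge0// ler_wpM2l ?exprn_ge0// ler_nat.
  by rewrite -!mulnn; nia.
by rewrite natrD [s ^+ n.+1]exprS; ring.
Qed.

Lemma monomial_split h alpha j : monomial h alpha =
  h j 0 ^+ alpha j * \prod_(i | i != j) h i 0 ^+ alpha i.
Proof. by rewrite /monomial (bigD1 j). Qed.

Lemma mdeg_split alpha j : mdeg alpha = (alpha j + \sum_(i | i != j) alpha i)%N.
Proof. by rewrite /mdeg (bigD1 j). Qed.

Definition mpred alpha j : index := [ffun i => if i == j then (alpha i).-1 else alpha i].

Lemma monomial_mpred h alpha j : monomial h (mpred alpha j) =
  h j 0 ^+ (alpha j).-1 * \prod_(i | i != j) h i 0 ^+ alpha i.
Proof.
rewrite (monomial_split _ _ j) ffunE eqxx; congr (_ * _).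
by apply: eq_bigr => i /negbTE ij; rewrite ffunE ij.
Qed.

Lemma mdeg_mpred alpha j : (0 < alpha j)%N -> (mdeg (mpred alpha j)).+1 = mdeg alpha.
Proof.
move=> aj; rewrite !(mdeg_split _ j) ffunE eqxx -addSn prednK//; congr (_ + _)%N.
by apply: eq_bigr => i /negbTE ij; rewrite ffunE ij.
Qed.

(** The factor [n ^ 2] of [exp_remainder_le] is absorbed by [4 ^ n], that is, by
    a ball four times larger. *)
Lemma monomial_remainder_le s h j t alpha : `|h| <= s ->
  `|h + t *: coord_vec j| <= s ->
  s ^+ 2 * `|monomial (h + t *: coord_vec j) alpha - monomial h alpha
             - ((alpha j)%:R * monomial h (mpred alpha j)) * t|
    <= `|t| ^+ 2 * (4 * s) ^+ mdeg alpha.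
Proof.
move=> hs hts; have s0 : 0 <= s by rewrite (le_trans _ hs).
pose P := \prod_(i | i != j) h i 0 ^+ alpha i.
have PE : \prod_(i | i != j) (h + t *: coord_vec j) i 0 ^+ alpha i = P.
  apply: eq_bigr => i /negbTE ij; rewrite !mxE ij /=.
  by rewrite mulr0 addr0.
rewrite monomial_mpred !(monomial_split _ alpha j) PE -/P.
have -> : (h + t *: coord_vec j) j 0 = h j 0 + t by rewrite !mxE !eqxx mulr1.
set x := h j 0; set n := alpha j.
have -> : (x + t) ^+ n * P - x ^+ n * P - n%:R * (x ^+ n.-1 * P) * t =
   P * ((x + t) ^+ n - x ^+ n - n%:R * x ^+ n.-1 * t) by ring.
have xs : `|x| <= s := le_trans (coord_le_norm h j) hs.
have xts : `|x + t| <= s.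
  by have := le_trans (coord_le_norm _ j) hts; rewrite !mxE !eqxx mulr1.
have Ps : `|P| <= s ^+ (\sum_(i | i != j) alpha i).
  rewrite normr_prod -prodrXr; apply: ler_prod => i _.
  by rewrite normr_ge0 normrX lerXn2r ?nnegrE// (le_trans (coord_le_norm h i)).
rewrite normrM mulrCA (mdeg_split _ j) -/n exprD.
apply: le_trans (ler_pM _ _ Ps (exp_remainder_le n xs xts)) _ => //.
  by rewrite mulr_ge0// exprn_ge0.
have n4 : (n ^ 2)%:R <= 4 ^+ n :> R.
  by rewrite -natrX ler_nat -(expnM 2 2) mulnC expnM leq_exp2r// ltnW// ltn_expl.
have sm : s ^+ (\sum_(i | i != j) alpha i) <= (4 * s) ^+ (\sum_(i | i != j) alpha i).
  by rewrite lerXn2r ?nnegrE ?mulr_ge0// ler_peMl// ler1n.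
set m := (\sum_(i | _) _)%N in sm *.
rewrite (_ : s ^+ m * _ = `|t| ^+ 2 * ((n ^ 2)%:R * s ^+ n * s ^+ m)); last by ring.
rewrite ler_wpM2l ?exprn_ge0// ler_pM ?mulr_ge0 ?exprn_ge0//.
by rewrite exprMn ler_wpM2r ?exprn_ge0.
Qed.

(** Partial derivatives are computed term by term; the termwise series is again
    absolutely summable, on a smaller ball because the exponents come down as
    factors. *)
Lemma power_series_derive a r M f j : 0 < r -> power_series_at a r M f ->
  power_series_at a (r / 8) (M / (r / 8)) (fun x => 'D_(coord_vec j) f x).
Proof.
(* The remainder estimate is used at points of norm at most 2 * s, and it needs
   the series to converge at radius 4 * (2 * s). *)
move=> r0 [c [cM cf]]; pose s := r / 8; have s0 : 0 < s by rewrite divr_gt0.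
pose N alpha := `|c alpha * (alpha j)%:R| * s ^+ mdeg (mpred alpha j).
have NM : abs_sum_le N (M / s).
  move=> A; rewrite ler_pdivlMr// mulr_suml; apply: le_trans (cM A).
  apply: ler_sum => alpha _; rewrite /N normrM normr_id !normrM -!mulrA ler_wpM2l//.
  have [->|aj] := posnP (alpha j).
    by rewrite normr0 mul0r.
  rewrite ger0_norm// normrX gtr0_norm// -exprSr mdeg_mpred// normrX gtr0_norm//.
  have -> : r = 8 * s by rewrite mulrC divfK.
  rewrite [(8 * s) ^+ _]exprMn ler_wpM2r ?exprn_ge0 ?(ltW s0)//.
  apply: (@le_trans _ _ (8 ^+ alpha j)); last first.
    by rewrite ler_weXn2l ?ler1n// (mdeg_split _ j) leq_addr.
  by rewrite -natrX ler_nat ltnW// ltn_expl.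
have termN alpha h : `|h| <= s ->
    `|c alpha * (alpha j)%:R * monomial h (mpred alpha j)| <= `|N alpha|.
  move=> hs; rewrite normrM [leRHS]ger0_norm ?mulr_ge0 ?exprn_ge0 ?(ltW s0)//.
  by rewrite ler_wpM2l// monomial_le.
apply: (@power_series_sum _ _ _
  (fun alpha x => c alpha * (alpha j)%:R * monomial (x - a) (mpred alpha j)) N) => //.
  move=> alpha; apply: power_series_monomial (ltW s0) _ => h _.
  by rewrite addrC addKr.
move=> h hs; under eq_fun do rewrite addrC addKr.
have [l hl] := abs_sum_sums_to (abs_sum_le_dom (fun alpha => termN alpha h hs) NM).
suff -> : 'D_(coord_vec j) f (a + h) = l by [].
have rs : r = 4 * (2 * s) by rewrite /s; field.
apply: (@partial_derivative_eq _ _ _ l (M / (2 * s) ^+ 2) s) => // t ts.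
have hts : `|h + t *: coord_vec j| <= 2 * s.
  rewrite (le_trans (ler_normD _ _))// mulr_natl mulr2n lerD//.
  by rewrite normrZ (le_trans _ ts)// ler_piMr// coord_vec_norm_le.
have hs2 : `|h| <= 2 * s by rewrite (le_trans hs)// ler_peMl ?ltW// ltr1n.
have ler : 2 * s <= r by rewrite rs; lra.
have s20 : 0 < (2 * s) ^+ 2 by rewrite exprn_gt0// mulr_gt0.
have := sums_toB (sums_toB (cf _ (le_trans hts ler)) (cf _ (le_trans hs2 ler)))
   (@sums_toZ _ _ _ _ t hl).
move=> /(@sums_toZ _ _ _ _ ((2 * s) ^+ 2)) hsum.
rewrite mulrAC ler_pdivlMr// -[X in _ * X](ger0_norm (ltW s20)) -normrM.
rewrite mulrC -[a + h + _]addrA [l * t]mulrC; apply: (sums_to_norm_le hsum).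
have : abs_sum_le (fun alpha => `|t| ^+ 2 * (c alpha * r ^+ mdeg alpha))
    (M * `|t| ^+ 2).
  rewrite [M * _]mulrC -[X in abs_sum_le _ (X * _)](ger0_norm (exprn_ge0 2 (normr_ge0 t))).
  exact: abs_sum_leZ.
apply: abs_sum_le_dom => alpha; rewrite rs.
have := monomial_remainder_le alpha hs2 hts.
move/(ler_wpM2l (normr_ge0 (c alpha))) => le1.
rewrite (_ : (2 * s) ^+ 2 * _ = c alpha * ((2 * s) ^+ 2 *
  (monomial (h + t *: coord_vec j) alpha - monomial h alpha -
    (alpha j)%:R * monomial h (mpred alpha j) * t))); last by ring.
rewrite normrM [ `|(2 * s) ^+ 2 * _|]normrM (ger0_norm (ltW s20)).
apply: le_trans le1 _.
have q0 : 0 <= (4 * (2 * s)) ^+ mdeg alpha.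
  by rewrite exprn_ge0// !mulr_ge0// ltW.
have t20 : 0 <= `|t| ^+ 2 by rewrite exprn_ge0.
by rewrite (normrM (`|t| ^+ 2)) (ger0_norm t20) normrM (ger0_norm q0) mulrCA.
Qed.

End Differentiation.

Section StrictDerivative.
Context {R : realType} {p : nat}.
Local Notation index := {ffun 'I_p -> nat}.
Implicit Types (a h v : 'cV[R]_p) (f g : 'cV[R]_p -> R) (alpha beta : index).

Lemma exp_diff_le (s x y d : R) n : 0 <= s -> `|x| <= s -> `|y| <= s ->
  `|x - y| <= d -> s * `|x ^+ n - y ^+ n| <= n%:R * s ^+ n * d.
Proof.
move=> s0 xs ys xyd; have d0 : 0 <= d by rewrite (le_trans _ xyd).
elim: n => [|n IH]; first by rewrite !expr0 subrr normr0 mulr0 !mul0r.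
have -> : x ^+ n.+1 - y ^+ n.+1 = x * (x ^+ n - y ^+ n) + (x - y) * y ^+ n.
  by rewrite !exprS; ring.
apply: (@le_trans _ _ (s * (n%:R * s ^+ n * d) + s * (d * s ^+ n))); last first.
  by rewrite -natr1 exprS le_eqVlt; apply/orP; left; apply/eqP; ring.
apply: le_trans (ler_wpM2l s0 (ler_normD _ _)) _; rewrite mulrDr lerD//.
  by rewrite normrM mulrCA ler_pM// mulr_ge0.
by rewrite ler_wpM2l// normrM normrX ler_pM ?exprn_ge0// lerXn2r ?nnegrE.
Qed.

(** The monomial of degree [n] has Lipschitz constant [n * s ^ (n - 1)] on the
    ball of radius [s]; both sides are multiplied by [s] to avoid the
    predecessor. *)
Lemma monomial_diff_le s h v alpha : `|h| <= s -> `|v| <= s ->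
  s * `|monomial h alpha - monomial v alpha|
    <= (mdeg alpha)%:R * s ^+ mdeg alpha * `|h - v|.
Proof.
move=> hs vs; have s0 : 0 <= s by rewrite (le_trans _ hs).
rewrite /monomial /mdeg; elim: (index_enum _) => [|i r IH].
  by rewrite !big_nil subrr normr0 mulr0 !mul0r.
rewrite !big_cons; set X := \prod_(j <- r) _ in IH *; set Y := \prod_(j <- r) _ in IH *.
set n := (\sum_(j <- r) _)%N in IH *; set x := h i 0; set y := v i 0.
have xs : `|x| <= s := le_trans (coord_le_norm h i) hs.
have ys : `|y| <= s := le_trans (coord_le_norm v i) vs.
have xy : `|x - y| <= `|h - v| by have := coord_le_norm (h - v) i; rewrite !mxE.
have Ys : `|Y| <= s ^+ n.
  rewrite normr_prod -prodrXr; apply: ler_prod => j _.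
  by rewrite normr_ge0 normrX lerXn2r ?nnegrE// (le_trans (coord_le_norm v j)).
have -> : x ^+ alpha i * X - y ^+ alpha i * Y =
   x ^+ alpha i * (X - Y) + (x ^+ alpha i - y ^+ alpha i) * Y by ring.
apply: (@le_trans _ _ (s ^+ alpha i * (n%:R * s ^+ n * `|h - v|) +
   (alpha i)%:R * s ^+ alpha i * `|h - v| * s ^+ n)); last first.
  by rewrite natrD exprD le_eqVlt; apply/orP; left; apply/eqP; ring.
apply: le_trans (ler_wpM2l s0 (ler_normD _ _)) _; rewrite mulrDr lerD//.
  by rewrite normrM mulrCA ler_pM ?mulr_ge0// normrX lerXn2r ?nnegrE.
rewrite normrM mulrA ler_pM ?mulr_ge0//.
exact: exp_diff_le.
Qed.

Lemma monomial_deg1 h alpha : mdeg alpha = 1%N ->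
  monomial h alpha = \sum_j (alpha j)%:R * h j 0.
Proof.
move=> /eqP /sum_nat_eq1[j [_ aj a0']].
have a0 i : i != j -> alpha i = 0%N by move=> ij; exact: a0'.
rewrite (bigD1 j)//= aj mul1r (monomial_split _ _ j) aj expr1.
rewrite !big1 ?mulr1 ?addr0// => i /a0 ->.
  by rewrite mul0r.
by rewrite expr0.
Qed.

(** A power series is strictly differentiable at its centre: the linear part
    is isolated by the terms of degree one, and differences of monomials of
    degree at least two at points of norm at most [s] gain a factor [s]. *)
Lemma power_series_strict_linear a r M f : 0 < r -> power_series_at a r M f ->
  exists (l : 'I_p -> R) (K : R), forall s h v, 0 < s -> s <= r / 2 ->
    `|h| <= s -> `|v| <= s ->
    `|f (a + h) - f (a + v) - \sum_j l j * (h j 0 - v j 0)| <= K * s * `|h - v|.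
Proof.
move=> r0 [c [cM cf]].
pose c1 alpha := if mdeg alpha == 1%N then c alpha else 0.
have c1M j : abs_sum_le (fun alpha => (alpha j)%:R * c1 alpha) (`|r^-1| * M).
  apply: abs_sum_le_dom (@abs_sum_leZ _ _ _ _ r^-1 cM) => alpha.
  rewrite /c1; case: eqP => [a1|_]; last by rewrite mulr0 normr0.
  rewrite a1 expr1 mulrCA mulVf ?gt_eqF// mulr1 normrM ler_piMl// ger0_norm//.
  by rewrite lern1; move: a1; rewrite (mdeg_split alpha j); lia.
have [l ll] := choice (fun j => abs_sum_sums_to (c1M j)).
exists l, (4 / r ^+ 2 * M) => s h v s0 sr hs vs.
have lsum : sums_to (fun alpha => c1 alpha * (monomial h alpha - monomial v alpha))
    (\sum_j l j * (h j 0 - v j 0)).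
  have := @sums_to_sum _ _ _ _ _ (index_enum 'I_p)
    (fun j => @sums_toZ _ _ _ _ (h j 0 - v j 0) (ll j)).
  under [X in sums_to _ X]eq_bigr do rewrite mulrC.
  congr sums_to; apply/funext => alpha; rewrite /c1; case: eqP => [a1|_]; last first.
    by rewrite mul0r big1// => j _; rewrite !mulr0.
  rewrite !monomial_deg1// -sumrB mulr_sumr; apply: eq_bigr => j _; ring.
have sr' : s <= r by apply: le_trans sr _; lra.
have := sums_toB (sums_toB (cf h (le_trans hs sr')) (cf v (le_trans vs sr'))) lsum.
move=> /sums_to_norm_le; apply.
(* For n >= 2 and s <= r / 2, n * s ^ (n - 1) <= 2 ^ n * s * (r / 2) ^ (n - 2), which
   is B * s * r ^ n. *)
set B := 4 / r ^+ 2; rewrite -mulrA mulrAC.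
have B0 : 0 <= B by rewrite divr_ge0// exprn_ge0// ltW.
rewrite -[X in abs_sum_le _ (X * _)]ger0_norm; last first.
  by rewrite mulr_ge0// mulr_ge0// (ltW s0).
apply: abs_sum_le_dom (@abs_sum_leZ _ _ _ _ (B * (s * `|h - v|)) cM) => alpha.
rewrite /c1; case: (eqVneq (mdeg alpha) 1%N) => [a1|a1].
  by rewrite [X in `|X|](_ : _ = 0) ?normr0//; ring.
rewrite [X in `|X| <= _](_ : _ = c alpha * (monomial h alpha - monomial v alpha)); last by ring.
rewrite mulrCA [leRHS]normrM normrM ler_wpM2l//.
have [a0|/eqP a0] := eqVneq (mdeg alpha) 0%N.
  have z w : monomial w alpha = 1 :> R.
    rewrite /monomial big1// => i _; move: a0; rewrite (mdeg_split alpha i).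
    by move=> /eqP; rewrite addn_eq0 => /andP[/eqP -> _].
  by rewrite !z subrr normr0.
have [n an] : exists n, mdeg alpha = (2 + n)%N.
  by exists (mdeg alpha - 2)%N; lia.
have := monomial_diff_le alpha hs vs; rewrite an => mle.
rewrite -(ler_pM2l s0); apply: le_trans mle _.
rewrite ger0_norm; last first.
  rewrite mulr_ge0 ?exprn_ge0 ?(ltW r0)//.
  by rewrite mulr_ge0// mulr_ge0// (ltW s0).
have n2 : (2 + n)%:R <= 2 ^+ (2 + n) :> R by rewrite -natrX ler_nat ltnW// ltn_expl.
have sn : s ^+ n <= (r / 2) ^+ n.
  by rewrite lerXn2r ?nnegrE// ltW// divr_gt0.
have -> : s * (B * (s * `|h - v|) * r ^+ (2 + n)) =
   2 ^+ (2 + n) * (s ^+ 2 * (r / 2) ^+ n) * `|h - v|.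
  rewrite /B !exprD exprMn exprVn; field.
  by rewrite !gt_eqF// exprn_gt0.
by rewrite ler_wpM2r// ler_pM// ?exprn_ge0 ?(ltW s0)// exprD ler_wpM2l// exprn_ge0// ltW.
Qed.

Lemma power_series_strict_derivative a r M f : 0 < r -> power_series_at a r M f ->
  exists K : R, forall s h v, 0 < s -> s <= r / 2 ->
    `|h| <= s -> `|v| <= s ->
    `|f (a + h) - f (a + v) - \sum_j 'D_(coord_vec j) f a * (h j 0 - v j 0)|
      <= K * s * `|h - v|.
Proof.
move=> r0 /(power_series_strict_linear r0)[l [K lK]].
suff Dl j : 'D_(coord_vec j) f a = l j.
  by exists K => s h v *; under eq_bigr do rewrite Dl; exact: lK.
apply: (@partial_derivative_eq _ _ _ _ _ _ K (r / 2)).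
  by rewrite divr_gt0.
move=> t tr; have [->|t0] := eqVneq t 0.
  by rewrite scale0r addr0 subrr mulr0 subr0 normr0 expr0n mulr0.
have tn : `|t *: coord_vec j : 'cV[R]_p| <= `|t|.
  by rewrite normrZ ler_piMr// coord_vec_norm_le.
have K0 : 0 <= K * `|t|.
  have := lK `|t| (t *: coord_vec j) 0; rewrite normr_gt0 t0 tr tn normr0 normr_ge0.
  move=> /(_ isT isT isT isT) /(le_trans (normr_ge0 _)).
  rewrite subr0 pmulr_lge0// normr_gt0 scaler_eq0 (negbTE t0) /=.
  apply/eqP => /matrixP/(_ j 0)/eqP.
  by rewrite coord_vecE eqxx mxE oner_eq0.
have := lK `|t| (t *: coord_vec j) 0; rewrite normr_gt0 t0 tr tn normr0 normr_ge0.
move=> /(_ isT isT isT isT); rewrite addr0 subr0.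
rewrite (bigD1 j)//= big1 ?addr0 => [|i /negbTE ij]; last first.
  by rewrite !mxE ij /= mulr0 subr0 mulr0.
rewrite !mxE !eqxx mulr1 subr0 => /le_trans -> //.
by rewrite expr2 mulrA ler_wpM2l.
Qed.

End StrictDerivative.

(** * Analytic functions *)

(** Convergence at the constant vector of positive entries [e / 2] is absolute,
    and it bounds the terms on the whole ball of that radius. *)
Lemma analytic_atP (R : realType) p (f : 'cV[R]_p -> R) a : analytic_at f a <->
  exists r M, 0 < r /\ power_series_at a r M f.
Proof.
split=> [[c /nbhs_ballP[e /= e0 ce]]|[r [M [r0 [c [_ cf]]]]]].
  have e20 : 0 < e / 2 by rewrite divr_gt0.
  have cf h : `|h| <= e / 2 ->
      sums_to (fun alpha => c alpha * monomial h alpha) (f (a + h)).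
    move=> he; have /ce : ball a e (a + h).
      rewrite -ball_normE /= opprD addNKr normrN.
      by apply: le_lt_trans he _; lra.
    rewrite /sums_to; congr (cvg_to (_ @ totally) _).
    by congr partial_sum; apply/funext => alpha; rewrite addrC addKr.
  have cn : `|const_mx (e / 2) : 'cV[R]_p| <= e / 2.
    by apply: norm_le_coord => [|i]; rewrite ?mxE ?gtr0_norm// ltW.
  have [M] := sums_to_abs_bounded (cf _ cn).
  under eq_fun do rewrite monomial_const.
  by move=> cM; exists (e / 2), M; split=> //; exists c.
exists c; apply/nbhs_ballP; exists r => //= x.
rewrite -ball_normE /= distrC => /ltW /cf.
by rewrite [a + _]addrC subrK.
Qed.

Section AnalyticFunctions.
Context {R : realType} {p : nat}.
Implicit Types (a h v : 'cV[R]_p) (f g : 'cV[R]_p -> R).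

Lemma analytic_at_const k a : analytic_at (fun=> k) a.
Proof. by apply/analytic_atP; exists 1, `|k|; split=> //; exact: power_series_const. Qed.

Lemma analytic_atD f g a : analytic_at f a -> analytic_at g a ->
  analytic_at (fun x => f x + g x) a.
Proof.
move=> /analytic_atP[r [M [r0 fM]]] /analytic_atP[s [N [s0 gN]]].
have m0 : 0 < Num.min r s by rewrite lt_min r0.
apply/analytic_atP; exists (Num.min r s), (M + N); split=> //.
apply: power_seriesD.
  by apply: power_series_le fM => //; rewrite ?(ltW m0)// ge_min lexx.
by apply: power_series_le gN => //; rewrite ?(ltW m0)// ge_min lexx orbT.
Qed.

Lemma analytic_atM f g a : analytic_at f a -> analytic_at g a ->
  analytic_at (fun x => f x * g x) a.
Proof.
move=> /analytic_atP[r [M [r0 fM]]] /analytic_atP[s [N [s0 gN]]].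
have m0 : 0 < Num.min r s by rewrite lt_min r0.
apply/analytic_atP; exists (Num.min r s), (M * N); split=> //.
apply: power_seriesM => //.
  by apply: power_series_le fM => //; rewrite ?(ltW m0)// ge_min lexx.
by apply: power_series_le gN => //; rewrite ?(ltW m0)// ge_min lexx orbT.
Qed.

Lemma analytic_at_coord i a : analytic_at (fun x : 'cV[R]_p => x i 0) a.
Proof.
have -> : (fun x : 'cV[R]_p => x i 0) = fun x => (x i 0 - a i 0) + a i 0.
  by apply/funext => x; rewrite subrK.
apply: analytic_atD; last exact: analytic_at_const.
by apply/analytic_atP; exists 1, 1; split=> //; exact: power_series_coord.
Qed.

Lemma analytic_at_sum (I : Type) (s : seq I) (P : pred I)
    (f : I -> 'cV[R]_p -> R) a :
  (forall i, P i -> analytic_at (f i) a) ->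
  analytic_at (fun x => \sum_(i <- s | P i) f i x) a.
Proof.
move=> fa; elim: s => [|i s IH].
  by under eq_fun do rewrite big_nil; exact: analytic_at_const.
case: (boolP (P i)) => [Pi|/negbTE Pi].
  by under eq_fun do rewrite big_cons Pi; apply: analytic_atD => //; exact: fa.
by under eq_fun do rewrite big_cons Pi.
Qed.

Lemma analytic_at_comp q (F : 'cV[R]_p -> 'cV[R]_q) (g : 'cV[R]_q -> R) a :
  (forall j, analytic_at (fun x => F x j 0) a) -> analytic_at g (F a) ->
  analytic_at (g \o F) a.
Proof.
move=> Fa /analytic_atP[s [M [s0 gM]]].
have /choice[r rP] : forall j, exists r, 0 < r /\
    power_series_at a r s (fun x => F x j 0 - F a j 0).
  move=> j; have /analytic_atP[r [N [r0 FN]]] := Fa j.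
  by have [r' /andP[r'0 _] Fr'] := power_series_shrink r0 FN s0; exists r'.
pose r0 := \big[Num.min/1]_j r j.
have r00 : 0 < r0.
  by rewrite /r0; elim/big_rec: _ => // j x _ x0; rewrite lt_min x0 andbT; case: (rP j).
apply/analytic_atP; exists r0, M; split=> //.
apply: (power_series_comp r00 (ltW s0) gM) => j.
apply: power_series_le (rP j).2 => //; first exact: ltW.
exact: bigmin_le.
Qed.

(** Ordinary convergence of a power series in one variable becomes absolute, hence
    unconditional, on a smaller interval. *)
Lemma analytic1_atP (g : R -> R) b : analytic1_at g b ->
  exists s M (d : nat -> R), [/\ 0 < s, abs_sum_le (fun n => d n * s ^+ n) M &
    forall t, `|t| <= s -> sums_to (fun n => d n * t ^+ n) (g (b + t))].
Proof.
move=> [d /nbhs_ballP[e /= e0 de]].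
pose s := e / 3; have s0 : 0 < s by rewrite divr_gt0.
have dg t : `|t| < e -> pseries d t @ \oo --> g (b + t).
  move=> te; have /de : ball b e (b + t).
    by rewrite -ball_normE /= opprD addNKr normrN.
  by rewrite addrC addKr.
have c2 : cvgn (pseries d (2 * s)).
  apply/cvg_ex; exists (g (b + 2 * s)); apply: dg.
  by rewrite gtr0_norm ?mulr_gt0// /s; lra.
have cs : cvgn (pseries (fun n => `|d n|) s).
  apply: (is_cvg_pseries_inside_norm c2).
  by rewrite !gtr0_norm ?mulr_gt0// ltr_pMl// ltr1n.
have nds : nondecreasing_seq (pseries (fun n => `|d n|) s).
  apply/nondecreasing_seqP => n; rewrite /pseries !seriesSr lerDl.
  by rewrite mulr_ge0// exprn_ge0// ltW.
pose M := limn (pseries (fun n => `|d n|) s).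
have dM : abs_sum_le (fun n => d n * s ^+ n) M.
  move=> A; have [N AN] : exists N, forall i, i \in A -> (i < N)%N.
    by exists (\max_(i <- A) i).+1 => i iA; rewrite ltnS; exact: leq_bigmax_seq.
  apply: le_trans (nondecreasing_cvgn_le nds cs N).
  have AB : (A `<=` [fset i in iota 0 N])%fset.
    by apply/fsubsetP => i /AN iN; rewrite !inE mem_iota.
  apply: le_trans (fset_sum_le (fun n => normr_ge0 (d n * s ^+ n)) AB) _.
  rewrite /pseries /series /= big_imfset//= /index_iota subn0 undup_id ?iota_uniq//.
  by apply: ler_sum => n _; rewrite normrM normrX (gtr0_norm s0).
exists s, M, d; split=> // t ts; apply: (@nat_sums_to _ _ M).
  apply: abs_sum_le_dom dM => n; rewrite !normrM ler_wpM2l// !normrX.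
  by rewrite lerXn2r ?nnegrE// [leRHS]gtr0_norm.
by apply: dg; apply: le_lt_trans ts _; rewrite /s; lra.
Qed.

Lemma analytic_at_comp1 f (g : R -> R) a :
  analytic_at f a -> analytic1_at g (f a) -> analytic_at (g \o f) a.
Proof.
move=> /analytic_atP[r [N [r0 fN]]] /analytic1_atP[s [M [d [s0 dM dg]]]].
have [r' /andP[r'0 _] fr'] := power_series_shrink r0 fN s0.
apply/analytic_atP; exists r', M; split=> //.
exact: (power_series_comp1 r'0 (ltW s0) dM dg fr').
Qed.

Lemma analytic1_at_expR b : analytic1_at (@expR R) b.
Proof.
exists (fun n => expR b / n`!%:R); near=> x.
have : expR b * series (exp_coeff (x - b)) n @[n --> \oo] -->
    expR b * limn (series (exp_coeff (x - b))).
  by apply: cvgMl_tmp; exact: is_cvg_series_exp_coeff.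
have -> : expR b * limn (series (exp_coeff (x - b))) = expR x.
  by rewrite -[limn _]/(expR (x - b)) -expRD addrC subrK.
congr (cvg_to (_ @ \oo) _); apply/funext => n; rewrite /pseries /series /=.
by rewrite mulr_sumr; apply: eq_bigr => i _; rewrite /exp_coeff /=; ring.
Unshelve. all: by end_near. Qed.

Lemma analytic1_at_inv (b : R) : b != 0 -> analytic1_at GRing.inv b.
Proof.
move=> b0; exists (fun n => b^-1 * (- b^-1) ^+ n).
apply/nbhs_ballP; exists `|b| => /=; first by rewrite normr_gt0.
move=> x; rewrite -ball_normE /= distrC => xb.
have lt1 : `|- b^-1 * (x - b)| < 1.
  by rewrite normrM normrN normfV mulrC ltr_pdivrMr ?normr_gt0// mul1r.
have := cvg_geometric_series (a := b^-1) lt1.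
have -> : b^-1 * (1 - - b^-1 * (x - b))^-1 = x^-1.
  have x0 : x != 0.
    by apply/eqP => x0; move: xb; rewrite x0 sub0r normrN ltxx.
  by field; rewrite b0 andbT; apply: contraNneq x0; lra.
congr (cvg_to (_ @ \oo) _); apply/funext => n; rewrite /pseries /series /=.
by apply: eq_bigr => i _; rewrite exprMn mulrA.
Qed.

Lemma analytic_at_derive f a j :
  analytic_at f a -> analytic_at (fun x => 'D_(coord_vec j) f x) a.
Proof.
move=> /analytic_atP[r [M [r0 fM]]]; apply/analytic_atP.
exists (r / 8), (M / (r / 8)); split; first by rewrite divr_gt0.
exact: power_series_derive.
Qed.

Lemma analytic_at_strict f a : analytic_at f a -> forall e, 0 < e ->
  exists2 d, 0 < d & forall x y, `|x - a| <= d -> `|y - a| <= d ->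
    `|f x - f y - \sum_j 'D_(coord_vec j) f a * (x j 0 - y j 0)| <= e * `|x - y|.
Proof.
move=> /analytic_atP[r [M [r0 fM]]] e e0.
have [K KP] := power_series_strict_derivative r0 fM.
have K1 : 0 < `|K| + 1 by rewrite ltr_wpDl.
pose d := Num.min (r / 2) (e / (`|K| + 1)).
have d0 : 0 < d by rewrite lt_min !divr_gt0.
exists d => // x y xd yd.
have dr : d <= r / 2 by rewrite ge_min lexx.
have := KP d (x - a) (y - a) d0 dr xd yd.
have xyE : x - a - (y - a) = x - y by rewrite opprB addrA subrK.
rewrite ![a + _]addrC !subrK xyE.
under eq_bigr => j _.
  rewrite (_ : (x - a) j 0 - (y - a) j 0 = x j 0 - y j 0); last by rewrite !mxE; ring.
  over.
move=> /le_trans; apply; rewrite ler_wpM2r//.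
apply: (@le_trans _ _ ((`|K| + 1) * (e / (`|K| + 1)))); last first.
  by rewrite mulrCA divff ?gt_eqF// mulr1.
apply: (@le_trans _ _ ((`|K| + 1) * d)).
  rewrite ler_wpM2r// ?(ltW d0)// (le_trans (ler_norm _))// lerDl//.
by rewrite ler_wpM2l ?(ltW K1)// ge_min lexx orbT.
Qed.

Lemma analytic_at_continuous f a : analytic_at f a -> {for a, continuous f}.
Proof.
move=> /analytic_atP[r [M [r0 fM]]]; apply/(@cvgrPdist_le _ R^o _ _ (nbhs_filter a)) => e e0.
have [r' /andP[r'0 _] fr'] := power_series_shrink r0 fM e0.
apply/nbhs_ballP; exists r' => //= x; rewrite -ball_normE /= distrC => /ltW xr.
rewrite distrC; have := power_series_bound fr' xr.
by rewrite [a + _]addrC subrK.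
Qed.

End AnalyticFunctions.

(** * Lebesgue outer measure *)

Section OuterMeasure.
Context {R : realType} {p : nat}.
Implicit Types A : set 'cV[R]_p.
Local Notation mu := (@lebesgue_outer_measure R p).

Definition box_cover A (D : set nat) (a b : nat -> 'cV[R]_p) : Prop :=
  (forall k, D k -> forall i, a k i 0 <= b k i 0) /\
  A `<=` \bigcup_(k in D) box (a k) (b k).

Definition cover_volume (D : set nat) (a b : nat -> 'cV[R]_p) : \bar R :=
  \esum_(k in D) (box_volume (a k) (b k))%:E.

Lemma box_volume_ge0 (a b : 'cV[R]_p) : (forall i, a i 0 <= b i 0) -> 0 <= box_volume a b.
Proof. by move=> ab; apply: prodr_ge0 => i _; rewrite subr_ge0. Qed.

Lemma outer_measure_le_cover A D a b :
  box_cover A D a b -> (mu A <= cover_volume D a b)%E.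
Proof. by move=> [ab AD]; apply: ereal_inf_lbound; exists D, a, b. Qed.

Lemma outer_measure_cover A e : 0 < e -> (mu A < +oo)%E -> exists D a b,
  box_cover A D a b /\ (cover_volume D a b <= mu A + e%:E)%E.
Proof.
move=> e0 Afin; have A0 : (0 <= mu A)%E.
  apply: le_ereal_inf_tmp => _ [D [a [b [ab _ ->]]]].
  by apply: esum_ge0 => k Dk; rewrite lee_fin box_volume_ge0//; exact: ab.
have fA : mu A \is a fin_num by rewrite ge0_fin_numE.
have [_ [D [a [b [ab AD ->]]]] lt] := lb_ereal_inf_adherent e0 fA.
by exists D, a, b; split=> //; exact: ltW.
Qed.

Lemma lebesgue_outer_measure0 : mu set0 = 0%E.
Proof.
apply/eqP; rewrite eq_le; apply/andP; split.
  have := @outer_measure_le_cover set0 set0 (fun=> 0) (fun=> 0).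
  by rewrite /cover_volume esum_set0; apply; split.
apply: le_ereal_inf_tmp => _ [D [a [b [ab _ ->]]]].
by apply: esum_ge0 => k Dk; rewrite lee_fin box_volume_ge0//; exact: ab.
Qed.

Lemma lebesgue_outer_measure_ge0 A : (0 <= mu A)%E.
Proof.
apply: le_ereal_inf_tmp => _ [D [a [b [ab _ ->]]]].
by apply: esum_ge0 => k Dk; rewrite lee_fin box_volume_ge0//; exact: ab.
Qed.

Lemma le_lebesgue_outer_measure : {homo mu : A B / A `<=` B >-> (A <= B)%E}.
Proof.
move=> A B AB; apply: le_ereal_inf_tmp => _ [D [a [b [ab BD ->]]]].
by apply: outer_measure_le_cover; split=> //; exact: subset_trans BD.
Qed.

(** Covers of the members, optimal up to [e / 2 ^ n.+1], are merged into one
    cover by a bijection between pairs and naturals. *)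
Lemma lebesgue_outer_measure_sigma_subadditive : sigma_subadditive mu.
Proof.
move=> A; have [[i ioo]|] := pselect (exists i, mu (A i) = +oo%E).
  rewrite (eseries_pinfty _ _ ioo) ?leey// => n _.
  by rewrite -ltNye (lt_le_trans _ (lebesgue_outer_measure_ge0 _)).
rewrite -forallNE => Aoo; apply/lee_addgt0Pr => e e0.
apply: le_trans (epsilon_trick _ _ (ltW e0)); last first.
  by move=> n; exact: lebesgue_outer_measure_ge0.
have /choice[D /choice[a /choice[b cov]]] : forall n, exists D a b,
    box_cover (A n) D a b /\
    (cover_volume D a b <= mu (A n) + (e / (2 ^ n.+1)%:R)%:E)%E.
  move=> n; apply: outer_measure_cover; first by rewrite divr_gt0// ltr0n expn_gt0.
  by rewrite ltey; apply/eqP/Aoo.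
have /card_esym/ppcard_eqP[f] := card_nat2.
pose v (i j : nat) := (box_volume (a i j) (b i j))%:E.
have v0 i j : D i j -> (0 <= v i j)%E.
  by move=> Dij; rewrite lee_fin box_volume_ge0//; exact: (cov i).1.1.
pose DD := [set k | D (f k).1 (f k).2].
have covA : box_cover (\bigcup_n A n) DD
   (fun k => a (f k).1 (f k).2) (fun k => b (f k).1 (f k).2).
  split=> [k Dk|x [n _ /(cov n).1.2[j Dj xj]]].
    by apply: (cov _).1.1.
  by exists (f^-1%FUN (n, j)); rewrite /DD /= invK ?inE.
apply: le_trans (outer_measure_le_cover covA) _.
have -> : cover_volume DD (fun k => a (f k).1 (f k).2)
    (fun k => b (f k).1 (f k).2) = \esum_(i in setT) cover_volume (D i) (a i) (b i).
  rewrite /cover_volume (esum_esum (a := v)); last by move=> i j _; exact: v0.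
  rewrite (@reindex_esum _ _ _ DD _ f) //; split.
  - by move=> k Dk; split.
  - by move=> i j _ _ /(congr1 (f^-1%FUN)); rewrite !funK ?inE.
  - by move=> [i j] [_ /= Dij]; exists (f^-1%FUN (i, j)); rewrite /DD /= invK ?inE.
rewrite -nneseries_esumT; last first.
  by move=> n; apply: esum_ge0 => j; exact: v0.
apply: lee_nneseries => [n _ _|n _].
  by apply: esum_ge0 => j; exact: v0.
exact: (cov n).2.
Qed.

End OuterMeasure.

HB.instance Definition _ (R : realType) (p : nat) :=
  isOuterMeasure.Build R 'cV[R]_p (@lebesgue_outer_measure R p)
    lebesgue_outer_measure0 lebesgue_outer_measure_ge0
    le_lebesgue_outer_measure lebesgue_outer_measure_sigma_subadditive.

Section NullSets.
Context {R : realType} {p : nat}.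
Implicit Types (A B : set 'cV[R]_p).
Local Notation mu := (@lebesgue_outer_measure R p).

Lemma measure_zero_sub A B : A `<=` B -> measure_zero B -> measure_zero A.
Proof.
move=> AB B0; apply/eqP; rewrite eq_le outer_measure_ge0 andbT -[leRHS]B0.
exact: le_outer_measure.
Qed.

Lemma measure_zero_bigcup (T : countType) (F : T -> set 'cV[R]_p) :
  (forall t, measure_zero (F t)) -> measure_zero (\bigcup_t F t).
Proof.
move=> F0; pose G n := if choice.unpickle n is Some t then F t else set0.
apply: (@measure_zero_sub _ (\bigcup_n G n)).
  by move=> x [t _ Ftx]; exists (choice.pickle t) => //; rewrite /G choice.pickleK.
apply/eqP; rewrite eq_le outer_measure_ge0 andbT.
apply: le_trans (outer_measure_sigma_subadditive _ _) _.
rewrite eseries0// => n _ _; rewrite /G.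
by case: (choice.unpickle n) => [t|]; [exact: F0|exact: outer_measure0].
Qed.

Lemma measure_zeroU A B : measure_zero A -> measure_zero B -> measure_zero (A `|` B).
Proof.
move=> A0 B0; apply: (@measure_zero_sub _ (\bigcup_(t : bool) if t then A else B)).
  by move=> x [Ax|Bx]; [exists true|exists false].
by apply: measure_zero_bigcup => -[].
Qed.

Lemma measure_zero0 : measure_zero (set0 : set 'cV[R]_p).
Proof. exact: outer_measure0. Qed.

Lemma outer_measure_box (a b : 'cV[R]_p) : (forall i, a i 0 <= b i 0) ->
  (mu (box a b) <= (box_volume a b)%:E)%E.
Proof.
move=> ab; rewrite -(@esum_set1 _ _ 0%N (fun=> (box_volume a b)%:E)); last first.
  by rewrite lee_fin box_volume_ge0.
apply: (@outer_measure_le_cover _ _ _ [set 0%N] (fun=> a) (fun=> b)).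
by split=> // x; exists 0%N.
Qed.

Definition shift_set (v : 'cV[R]_p) A : set 'cV[R]_p := [set x | A (x - v)].

Lemma shift_setK v A : shift_set v (shift_set (- v) A) = A.
Proof. by apply/funext => x; rewrite /shift_set /= opprK subrK. Qed.

Lemma outer_measure_shift v A : mu (shift_set v A) = mu A.
Proof.
have le w B : (mu (shift_set w B) <= mu B)%E.
  apply: le_ereal_inf_tmp => _ [D [a [b [ab BD ->]]]].
  have -> : \esum_(k in D) (box_volume (a k) (b k))%:E =
      cover_volume D (fun k => a k + w) (fun k => b k + w).
    apply: eq_esum => k _; congr (_%:E); apply: eq_bigr => i _.
    by rewrite !mxE; ring.
  apply: outer_measure_le_cover; split=> [k Dk i|x /BD[k Dk xk]].
    by rewrite !mxE lerD2r; exact: ab.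
  exists k => // i; move: (xk i); rewrite !mxE.
  by rewrite lerBrDr lerBlDr.
by apply/eqP; rewrite eq_le le -{1}[A](shift_setK (- v)) opprK le.
Qed.

Lemma caratheodory_shift v A : mu.-caratheodory A -> mu.-caratheodory (shift_set v A).
Proof.
move=> mA X; rewrite -[X](shift_setK v).
set Y := shift_set (- v) X.
have -> : shift_set v Y `&` shift_set v A = shift_set v (Y `&` A) by [].
have -> : shift_set v Y `&` ~` shift_set v A = shift_set v (Y `&` ~` A) by [].
by rewrite !outer_measure_shift -mA outer_measure_shift.
Qed.

Lemma box_volume_split (a b : 'cV[R]_p) i (c : R) :
  box_volume a (\col_j if j == i then c else b j 0) +
  box_volume (\col_j if j == i then c else a j 0) b = box_volume a b.
Proof.
rewrite /box_volume !(bigD1 i (P := predT))//= !mxE eqxx.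
under eq_bigr => j /negbTE ji do rewrite mxE ji.
under [in X in _ + X = _]eq_bigr => j /negbTE ji do rewrite mxE ji.
by ring.
Qed.

(** Clipping [c] to the sides of each box of a cover cuts the box into two boxes,
    possibly degenerate, whose volumes add up exactly. *)
Lemma caratheodory_halfspace i (c : R) : mu.-caratheodory [set x | x i 0 <= c].
Proof.
apply: le_caratheodory_measurable => X.
apply: le_ereal_inf_tmp => _ [D [a [b [ab XD ->]]]].
pose m k := Num.max (a k i 0) (Num.min (b k i 0) c).
have am k : a k i 0 <= m k by rewrite le_max lexx.
have mb k : D k -> m k <= b k i 0.
  by move=> Dk; rewrite ge_max ab//= ge_min lexx.
pose b' k : 'cV[R]_p := \col_j if j == i then m k else b k j 0.
pose a' k : 'cV[R]_p := \col_j if j == i then m k else a k j 0.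
have ab' k : D k -> forall j, a k j 0 <= b' k j 0.
  by move=> Dk j; rewrite mxE; case: eqP => [->|_]//; exact: ab.
have a'b k : D k -> forall j, a' k j 0 <= b k j 0.
  by move=> Dk j; rewrite mxE; case: eqP => [->|_]; [exact: mb|exact: ab].
have -> : \esum_(k in D) (box_volume (a k) (b k))%:E =
    (cover_volume D a b' + cover_volume D a' b)%E.
  rewrite /cover_volume -esumD.
  - by apply: eq_esum => k _; rewrite -EFinD box_volume_split.
  - by move=> k Dk; rewrite lee_fin box_volume_ge0//; exact: ab'.
  - by move=> k Dk; rewrite lee_fin box_volume_ge0//; exact: a'b.
apply: leeD; apply: outer_measure_le_cover; split=> //.
  move=> x [/XD[k Dk xk] /= xc]; exists k => // j.
  have /andP[axj xbj] := xk j; rewrite axj mxE /=.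
  case: eqP => [ji|//]; subst j; rewrite /m le_max; apply/orP; right.
  by rewrite le_min xbj.
move=> x [/XD[k Dk xk] /= /negP]; rewrite -ltNge => cx; exists k => // j.
have /andP[axj xbj] := xk j; rewrite xbj mxE andbT.
case: eqP => [ji|//]; subst j; rewrite /m ge_max axj /=.
by rewrite ge_min (ltW cx) orbT.
Qed.

End NullSets.

(** * Measurable sets and families with finite overlap *)

Section OpenSets.
Context {R : realType} {p : nat}.
Implicit Types (A U : set 'cV[R]_p) (a : 'cV[R]_p).
Local Notation mu := (@lebesgue_outer_measure R p).

(** Boxes with rational centre and radius, a countable neighbourhood base: open
    sets are countable unions of them, and a locally null set is null. *)
Definition rational_box (q : 'cV[rat]_p * nat) : set 'cV[R]_p :=
  [set x | forall i, `|x i 0 - ratr (q.1 i 0)| <= q.2.+1%:R^-1].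

Lemma rational_box_sub U a : nbhs a U ->
  exists q, rational_box q a /\ rational_box q `<=` U.
Proof.
move=> /nbhs_ballP[e /= e0 aU].
have [n ne] : exists n, n.+1%:R^-1 < e / 2.
  by have [n] := @ltr_add_invr R 0 (e / 2) (divr_gt0 e0 (ltr0Sn _ _)); rewrite add0r; exists n.
have n0 : 0 < n.+1%:R^-1 :> R by rewrite invr_gt0.
have /choice[q qP] : forall i, exists r : rat, `|a i 0 - ratr r| <= n.+1%:R^-1.
  move=> i; have ai : a i 0 < a i 0 + n.+1%:R^-1 by rewrite ltrDl.
  have [r] := rat_in_itvoo ai; rewrite in_itv /= => /andP[r1 r2]; exists r.
  by rewrite distrC gtr0_norm ?subr_gt0// lerBlDl ltW.
exists (\col_i q i, n); split=> [i|x xq]; first by rewrite mxE.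
apply: aU; rewrite -ball_normE /=.
apply: (@le_lt_trans _ _ (2 * n.+1%:R^-1)); last by rewrite mulrC -ltr_pdivlMr.
apply: norm_le_coord => [|i]; first by rewrite mulr_ge0// ltW.
have := xq i; have := qP i; rewrite /= !mxE distrC => h1 h2.
have -> : a i 0 - x i 0 = - (ratr (q i) - a i 0) - (x i 0 - ratr (q i)) by ring.
by rewrite (le_trans (ler_normB _ _))// normrN mulr_natl mulr2n lerD.
Qed.

Lemma caratheodory_countable_bigcup (T : countType) (F : T -> set 'cV[R]_p) :
  (forall t, mu.-caratheodory (F t)) -> mu.-caratheodory (\bigcup_t F t).
Proof.
move=> mF; apply: (@countable_bigcupT_measurable _ (caratheodory_type mu)) => //.
Qed.

Lemma caratheodory_setC A : mu.-caratheodory A -> mu.-caratheodory (~` A).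
Proof. exact: caratheodory_measurable_setC. Qed.

Lemma caratheodory_box (a b : 'cV[R]_p) : mu.-caratheodory (box a b).
Proof.
have -> : box a b = ~` \bigcup_i ~` ([set x | x i 0 <= b i 0] `&`
   ~` \bigcup_(n : nat) [set x | x i 0 <= a i 0 - n.+1%:R^-1]).
  apply/seteqP; split=> x /=.
    move=> xq [i _]; apply; have /andP[h1 h2] := xq i.
    split=> // -[n _ /=]; apply/negP; rewrite -ltNge (lt_le_trans _ h1)//.
    by rewrite ltrBlDr ltrDl invr_gt0.
  move=> xq i; apply: contrapT => xi; apply: xq; exists i => // -[/= h1 h2].
  apply: xi; rewrite h1 andbT leNgt; apply/negP.
  move=> /ltr_add_invr[n hn]; apply: h2; exists n => //=.
  by rewrite lerBrDr ltW.
apply: caratheodory_setC; apply: caratheodory_countable_bigcup => i.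
apply: caratheodory_setC; apply: caratheodory_measurable_setI.
  exact: caratheodory_halfspace.
apply: caratheodory_setC; apply: caratheodory_countable_bigcup => n.
exact: caratheodory_halfspace.
Qed.

Lemma caratheodory_rational_box q : mu.-caratheodory (rational_box q).
Proof.
have -> : rational_box q = box (\col_i (ratr (q.1 i 0) - q.2.+1%:R^-1))
    (\col_i (ratr (q.1 i 0) + q.2.+1%:R^-1)).
  by apply/seteqP; split=> x xq i; have := xq i; rewrite !mxE ler_distl.
exact: caratheodory_box.
Qed.

Lemma caratheodory_open U : open U -> mu.-caratheodory U.
Proof.
move=> oU.
have -> : U = \bigcup_(q : 'cV[rat]_p * nat)
    if `[< rational_box q `<=` U >] then rational_box q else set0.
  apply/seteqP; split=> [x Ux|x [q _]]; last by case: asboolP => [|_ []]; apply.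
  have [|q [qx qU]] := @rational_box_sub U x; first exact: open_nbhs_nbhs.
  by exists q => //; case: asboolP.
apply: caratheodory_countable_bigcup => q; case: ifP => _.
  exact: caratheodory_rational_box.
exact: caratheodory_measurable_set0.
Qed.

Lemma open_preimage U (g : 'cV[R]_p -> R) (V : set R) : open U -> open V ->
  (forall x, U x -> {for x, continuous g}) -> open (U `&` g @^-1` V).
Proof.
move=> oU oV cg; rewrite openE => x [Ux Vx].
apply: filterI; first exact: open_nbhs_nbhs.
by apply: (cg x Ux); exact: open_nbhs_nbhs.
Qed.

Lemma caratheodory_level U (g : 'cV[R]_p -> R) c : open U ->
  (forall x, U x -> {for x, continuous g}) ->
  mu.-caratheodory (U `&` [set x | g x = c]).
Proof.
move=> oU cg.
have -> : U `&` [set x | g x = c] = U `&` ~` (U `&` g @^-1` [set~ c]).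
  apply/seteqP; split=> x [Ux /= gx]; split=> //; first by case.
  by apply: contrapT => gxc; apply: gx.
apply: caratheodory_measurable_setI; first exact: caratheodory_open.
apply: caratheodory_setC; apply: caratheodory_open; apply: open_preimage => //.
by apply: closed_openC; exact: closed_eq.
Qed.

(** A family of measurable sets such that each point lies in finitely many of
    them has at most countably many members of positive measure: if infinitely
    many members had measure at least [1 / k.+1] inside one cube, their upper
    limit would have positive measure, but it is empty. *)
Lemma countable_positive_measure (A : R -> set 'cV[R]_p) :
  (forall t, mu.-caratheodory (A t)) -> (forall x, finite_set [set t | A t x]) ->
  countable [set t | ~ measure_zero (A t)].
Proof.
move=> mA finA.
pose cube (n : nat) : set 'cV[R]_p := box (const_mx (- n%:R)) (const_mx n%:R).
have mcube n : mu.-caratheodory (cube n) by exact: caratheodory_box.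
pose S n k := [set t | (k.+1%:R^-1%:E <= mu (A t `&` cube n))%E].
apply: (@sub_countable _ _ _ (\bigcup_n \bigcup_k S n k)).
  apply: subset_card_le => t /= At.
  have [n An] : exists n, ~ measure_zero (A t `&` cube n).
    apply: contrapT => /forallNP A0; apply: At.
    apply: (@measure_zero_sub _ _ _ (\bigcup_n (A t `&` cube n))).
      move=> x Ax; exists (Num.truncn `|x|).+1 => //; split=> // i; rewrite !mxE.
      rewrite -ler_norml; apply: le_trans (coord_le_norm x i) _.
      exact/ltW/truncnS_gt.
    by apply: measure_zero_bigcup => n; apply: contrapT; exact: A0.
  exists n => //.
  have : (0 < mu (A t `&` cube n))%E.
    by rewrite lt_neqAle outer_measure_ge0 andbT eq_sym; apply/eqP.
  rewrite /S; case muE : (mu _) => [r| |] // => [r0|_].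
    have [k] := ltr_add_invr r0; rewrite add0r => kr.
    by exists k; rewrite //= muE lee_fin ltW.
  by exists 0%N; rewrite //= muE leey.
apply: bigcup_countable => [|n _]; first exact: countableP.
apply: bigcup_countable => [|k _]; first exact: countableP.
apply: finite_set_countable; apply: contrapT => /infiniteP/ppcard_leP[f].
(* The sets E m decrease to the upper limit of the members, which is empty. *)
pose E m := \bigcup_j (A (f (m + j)%N) `&` cube n).
have mE m : mu.-caratheodory (E m).
  apply: caratheodory_countable_bigcup => j.
  exact: caratheodory_measurable_setI.
have Ecube m : E m `<=` cube n by move=> x [j _ []].
have muE0 : (mu (E 0%N) < +oo)%E.
  apply: le_lt_trans (le_outer_measure mu _ _ (Ecube 0%N)) _.
  apply: le_lt_trans (outer_measure_box _) (ltry _) => i.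
  by rewrite !mxE (@le_trans _ _ 0)// oppr_le0.
have Edec : nonincreasing_seq E.
  apply/nonincreasing_seqP => m; apply/subsetPset => x [j _ xj].
  by exists j.+1 => //; rewrite addnS -addSn.
have Ecap : \bigcap_m E m = set0.
  apply/seteqP; split=> // x Ex.
  have fin : finite_set [set j | A (f j) x].
    apply: (@finite_preimage _ _ [set t | A t x] f) (finA x).
    by move=> i j _ _; apply: (@inj _ _ _ f); rewrite inE.
  move/finite_fsetP: fin => [X XE].
  have [j _ [Aj _]] := Ex (\max_(i <- X) i).+1 I.
  have jX : ((\max_(i <- X) i).+1 + j)%N \in X.
    by have : [set` X] ((\max_(i <- X) i).+1 + j)%N by rewrite -XE.
  have : ((\max_(i <- X) i).+1 + j <= \max_(i <- X) i)%N.
    exact: (leq_bigmax_seq _ jX).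
  by rewrite addSn ltnNge leq_addr.
pose nu : {outer_measure set 'cV[R]_p -> \bar R} := mu.
pose nu' : {measure set (caratheodory_type nu) -> \bar R} := nu.
have := @nonincreasing_cvg_mu _ _ _ nu' E muE0 mE.
rewrite Ecap => /(_ (caratheodory_measurable_set0 _) Edec).
rewrite (measure0 nu') => Ecvg.
have : (k.+1%:R^-1%:E <= 0 :> \bar R)%E.
  rewrite -(cvg_lim _ Ecvg)//; apply: lime_ge.
    by apply/cvg_ex; exists 0%E.
  near=> m; apply: (@le_trans _ _ (mu (A (f m) `&` cube n))).
    by have := @funS _ _ _ _ f m I.
  by apply: le_outer_measure => x Ax; exists 0%N; rewrite ?addn0.
by rewrite lee_fin leNgt invr_gt0 ltr0Sn.
Unshelve. all: by end_near. Qed.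

Lemma uncountable_line : ~ countable [set: R].
Proof.
move=> /countable_lebesgue_measure0 R0.
have : (lebesgue_measure `[0%R, 1%R]%classic <= lebesgue_measure [set: R])%E.
  by apply: le_measure; rewrite ?inE.
by rewrite R0 lebesgue_measure_itv /= lte_fin ltr01 sube0 lee_fin ler10.
Qed.

(** The translates of a level set along a direction in which [g] has unit slope
    are disjoint and all have the same measure; there are uncountably many of
    them, so they are null. *)
Lemma level_set_null U (g : 'cV[R]_p -> R) (v : 'cV[R]_p) c : open U ->
  (forall x, U x -> {for x, continuous g}) ->
  (forall x t, g (x + t *: v) = g x + t) ->
  measure_zero (U `&` [set x | g x = c]).
Proof.
move=> oU cg gv; set A := U `&` _.
have mA t : mu.-caratheodory (shift_set (t *: v) A).
  exact/caratheodory_shift/caratheodory_level.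
have finA x : finite_set [set t | shift_set (t *: v) A x].
  apply: sub_finite_set (finite_set1 (g x - c)) => t [_ /=].
  by rewrite -scaleNr gv => <-; rewrite opprD opprK addNKr.
have [t At] : exists t, measure_zero (shift_set (t *: v) A).
  apply: contrapT => /forallNP A0; apply: uncountable_line.
  apply: sub_countable (countable_positive_measure mA finA).
  by apply: subset_card_le => t _; exact: A0.
by rewrite /measure_zero -(outer_measure_shift (t *: v)).
Qed.

End OpenSets.

(** * Null preimages under expanding maps *)

Section ExpandingMaps.
Context {R : realType} {p : nat}.
Implicit Types (V : set 'cV[R]_p) (F : 'cV[R]_p -> 'cV[R]_p).
Local Notation mu := (@lebesgue_outer_measure R p).

Lemma box_thicken (a b : 'cV[R]_p) e : 0 < e ->
  exists2 t, 0 < t & box_volume a (b + const_mx t) <= box_volume a b + e.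
Proof.
move=> e0; pose P : {poly R} := \prod_i ((b i 0 - a i 0)%:P + 'X).
have PE t : P.[t] = box_volume a (b + const_mx t).
  by rewrite /P horner_prod; apply: eq_bigr => i _; rewrite !hornerE !mxE; ring.
have /(@cvgrPdist_le _ R^o _ _ (nbhs_filter 0))/(_ e e0) := @continuous_horner R P 0.
move=> /nbhs_ballP[d /= d0 dP]; exists (d / 2); first by rewrite divr_gt0.
have /dP : ball 0 d (d / 2).
  by rewrite -ball_normE /= sub0r normrN gtr0_norm ?divr_gt0//; lra.
rewrite /= !PE distrC => /(le_trans (ler_norm _)).
by rewrite lerBlDl (_ : const_mx 0 = 0) ?addr0//; apply/matrixP => i j; rewrite !mxE.
Qed.

Section Preimage.
Context (F : 'cV[R]_p -> 'cV[R]_p) (V : set 'cV[R]_p) (C : R) (C0 : 0 < C)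
  (expF : forall x y, V x -> V y -> `|x - y| <= C * `|F x - F y|).

Let W a b := V `&` F @^-1` box a b.

(** The preimage has diameter at most [2 * C * m], so it lies in a cube of side
    [4 * C * m], whose volume is comparable to that of a box with sides at least
    [m]. *)
Lemma preimage_fat_box (a b : 'cV[R]_p) m : 0 < m ->
  (forall i, m <= b i 0 - a i 0 <= 2 * m) ->
  (mu (W a b) <= ((4 * C) ^+ p * box_volume a b)%:E)%E.
Proof.
move=> m0 abm.
have vm : m ^+ p <= box_volume a b.
  rewrite -{1}[p]card_ord -prodr_const; apply: ler_prod => i _.
  by case/andP: (abm i) => -> _; rewrite ltW.
have [W0|/set0P[x0 [Vx0 Fx0]]] := eqVneq (W a b) set0.
  rewrite W0 outer_measure0 lee_fin mulr_ge0 ?exprn_ge0 ?mulr_ge0 ?(ltW C0)//.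
  by rewrite (le_trans _ vm)// exprn_ge0// ltW.
have d0 : 0 <= C * (2 * m) by rewrite !mulr_ge0// ltW.
apply: (@le_trans _ _ (mu (box (x0 - const_mx (C * (2 * m))) (x0 + const_mx (C * (2 * m)))))).
  apply: le_outer_measure => x [Vx Fx] i; rewrite !mxE -ler_distl.
  have := coord_le_norm (x - x0) i; rewrite !mxE => /le_trans; apply.
  apply: le_trans (expF Vx Vx0) _; rewrite ler_wpM2l ?(ltW C0)//.
  apply: norm_le_coord => [|j]; first by rewrite mulr_ge0// ltW.
  rewrite !mxE; have /andP[l1 u1] := Fx j; have /andP[l2 u2] := Fx0 j.
  have /andP[_ ab2] := abm j; apply: le_trans ab2; rewrite ler_norml; apply/andP; split; lra.
apply: le_trans (outer_measure_box _) _.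
  by move=> i; rewrite !mxE; lra.
rewrite lee_fin /box_volume; under eq_bigr do rewrite !mxE.
rewrite [leLHS](_ : _ = (4 * C) ^+ p * m ^+ p); last first.
  rewrite -exprMn (_ : _ ^+ p = \prod_(i < p) (4 * C * m)).
    by apply: eq_bigr => i _; ring.
  by rewrite prodr_const card_ord.
by rewrite ler_wpM2l// exprn_ge0// mulr_ge0// ltW.
Qed.

(** Bisecting a side longer than [2 * m] keeps all sides at least [m] and halves
    the volume, so it ends after finitely many steps with nearly cubic boxes. *)
Lemma preimage_box_bisect n (a b : 'cV[R]_p) m : 0 < m ->
  (forall i, m <= b i 0 - a i 0) -> box_volume a b <= 2 ^+ n * m ^+ p ->
  (mu (W a b) <= ((4 * C) ^+ p * box_volume a b)%:E)%E.
Proof.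
move=> m0; elim: n a b => [|n IH] a b abm vol.
all: have [fat|] := pselect (forall i, b i 0 - a i 0 <= 2 * m);
  first by apply: (preimage_fat_box m0) => i; rewrite abm fat.
all: move=> /existsNP[i /negP]; rewrite -ltNge => thin.
all: pose c := (a i 0 + b i 0) / 2.
all: pose b' : 'cV[R]_p := \col_j if j == i then c else b j 0.
all: pose a' : 'cV[R]_p := \col_j if j == i then c else a j 0.
all: have b'a j : m <= b' j 0 - a j 0
  by rewrite mxE; case: eqP => [->|_]; [rewrite /c; lra|exact: abm].
all: have ba' j : m <= b j 0 - a' j 0
  by rewrite mxE; case: eqP => [->|_]; [rewrite /c; lra|exact: abm].
all: have volE : box_volume a b' + box_volume a' b = box_volume a b
  by exact: box_volume_split.
all: have halves : box_volume a b' = box_volume a' b.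
1, 3: rewrite /box_volume !(bigD1 i (P := predT))//= !mxE eqxx.
1, 2: congr (_ * _); [rewrite /c; lra|].
1, 2: by apply: eq_bigr => j /negbTE ji; rewrite !mxE ji.
- have : m ^+ p <= box_volume a b'.
    rewrite -{1}[p]card_ord -prodr_const; apply: ler_prod => j _.
    by rewrite b'a ltW.
  have := exprn_gt0 p m0; rewrite expr0 in vol; move=> *; exfalso; lra.
- have hv : box_volume a b' <= 2 ^+ n * m ^+ p by rewrite exprS in vol; lra.
  have sub : W a b `<=` W a b' `|` W a' b.
    move=> x [Vx Fx]; have [xc|cx] := leP (F x i 0) c; [left|right]; split=> // j.
      by have /andP[l u] := Fx j; rewrite mxE l; case: eqP => [->|].
    have /andP[l u] := Fx j; rewrite mxE u andbT; case: eqP => [->|//].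
    exact: ltW.
  apply: le_trans (le_outer_measure mu _ _ sub) _.
  apply: le_trans (outer_measureU2 _ _ _) _.
  rewrite -volE mulrDr EFinD; apply: leeD; apply: IH => //.
  by rewrite -halves.
Qed.

(** Thickening gives a degenerate box sides of positive length. *)
Lemma preimage_box (a b : 'cV[R]_p) : (forall i, a i 0 <= b i 0) ->
  (mu (W a b) <= ((4 * C) ^+ p * box_volume a b)%:E)%E.
Proof.
move=> ab; apply/lee_addgt0Pr => e e0; pose K := (4 * C) ^+ p.
have K0 : 0 < K by rewrite exprn_gt0// mulr_gt0.
have [t t0 vt] := box_thicken a b (divr_gt0 e0 K0).
have [n nt] : exists n, box_volume a (b + const_mx t) <= 2 ^+ n * t ^+ p.
  pose x := box_volume a (b + const_mx t) / t ^+ p.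
  exists (Num.truncn x).+1; rewrite -ler_pdivrMr ?exprn_gt0// -/x.
  apply: le_trans (ltW (truncnS_gt x)) _.
  by rewrite -natrX ler_nat ltnW// ltn_expl.
have side i : t <= (b + const_mx t) i 0 - a i 0 by rewrite !mxE; have := ab i; lra.
apply: (@le_trans _ _ (mu (W a (b + const_mx t)))).
  apply: le_outer_measure => x [Vx Fx]; split=> // i; rewrite !mxE.
  by have /andP[-> u] := Fx i; rewrite (le_trans u)// lerDl ltW.
apply: le_trans (preimage_box_bisect t0 side nt) _.
rewrite -EFinD lee_fin -/K; apply: le_trans (ler_wpM2l (ltW K0) vt) _.
by rewrite mulrDr [K * (e / K)]mulrCA divff ?gt_eqF// mulr1.
Qed.

(** A map that does not shrink distances by more than the factor [C] pulls null
    sets back to null sets, because it pulls nearly cubic boxes back to sets of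
    comparable diameter. *)
Lemma null_preimage_expanding B : measure_zero B -> measure_zero (V `&` F @^-1` B).
Proof.
move=> B0; pose K := (4 * C) ^+ p.
have K0 : 0 < K by rewrite exprn_gt0// mulr_gt0.
apply/eqP; rewrite eq_le outer_measure_ge0 andbT.
apply/lee_addgt0Pr => e e0; rewrite add0e.
have Bfin : (mu B < +oo)%E by rewrite [mu B]B0.
have [D [a [b [[ab BD] vol]]]] := outer_measure_cover (divr_gt0 e0 K0) Bfin.
pose G k := if k \in D then W (a k) (b k) else set0.
apply: (@le_trans _ _ (mu (\bigcup_k G k))).
  apply: le_outer_measure => x [Vx /BD[k Dk Fx]]; exists k => //.
  by rewrite /G mem_set.
apply: le_trans (outer_measure_sigma_subadditive _ _) _.
pose w k := if k \in D then (box_volume (a k) (b k))%:E else 0%E.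
have w0 k : (0 <= w k)%E.
  by rewrite /w; case: ifPn => // /set_mem Dk; rewrite lee_fin box_volume_ge0//; exact: ab.
apply: (@le_trans _ _ (\sum_(k <oo) K%:E * w k)%E).
  apply: lee_nneseries => [k _ _|k _]; first exact: outer_measure_ge0.
  rewrite /G /w; case: ifPn => [/set_mem Dk|_]; last by rewrite outer_measure0 mule0.
  by rewrite -EFinM; apply: preimage_box; exact: ab.
rewrite nneseriesZl// nneseries_esumT// -esum_mkcond.
apply: (@le_trans _ _ (K%:E * (e / K)%:E)%E).
  by apply: lee_wpmul2l; [rewrite lee_fin ltW|move: vol; rewrite [mu B]B0 add0e].
by rewrite -EFinM lee_fin mulrCA divff ?gt_eqF// mulr1.
Qed.

End Preimage.
End ExpandingMaps.

(** * Analyticity of networks almost everywhere *)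

Lemma open_finite_bigcap (T : topologicalType) (I : finType) (U : I -> set T) :
  (forall i, open (U i)) -> open (\bigcap_(i in [set: I]) U i).
Proof.
move=> oU; rewrite openE => x Ux.
have : \forall y \near x, forall i, U i y.
  by apply: filter_forall => i; apply: open_nbhs_nbhs; split=> //; exact: Ux.
by apply: filterS => y Uy i _.
Qed.

Section AnalyticMatrices.
Context {R : realType} {p : nat}.
Implicit Types U : set 'cV[R]_p.

Definition mx_analytic_on U m n (F : 'cV[R]_p -> 'M[R]_(m, n)) : Prop :=
  forall i j, analytic_on U (fun w => F w i j).

Lemma analytic_at_ext (f g : 'cV[R]_p -> R) w :
  f =1 g -> analytic_at f w -> analytic_at g w.
Proof. by move=> /funext ->. Qed.

Lemma mx_analytic_mul U m n q (F : 'cV[R]_p -> 'M[R]_(m, n))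
    (G : 'cV[R]_p -> 'M[R]_(n, q)) : mx_analytic_on U F -> mx_analytic_on U G ->
  mx_analytic_on U (fun w => F w *m G w).
Proof.
move=> aF aG i j w Uw; apply: (@analytic_at_ext (fun w => \sum_k F w i k * G w k j)).
  by move=> x; rewrite mxE.
by apply: analytic_at_sum => k _; apply: analytic_atM; [exact: aF|exact: aG].
Qed.

Lemma mx_analytic_add U m n (F G : 'cV[R]_p -> 'M[R]_(m, n)) :
  mx_analytic_on U F -> mx_analytic_on U G -> mx_analytic_on U (fun w => F w + G w).
Proof.
move=> aF aG i j w Uw; apply: (@analytic_at_ext (fun w => F w i j + G w i j)).
  by move=> x; rewrite mxE.
by apply: analytic_atD; [exact: aF|exact: aG].
Qed.

Lemma mx_analytic_scale U m n k (F : 'cV[R]_p -> 'M[R]_(m, n)) :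
  mx_analytic_on U F -> mx_analytic_on U (fun w => k *: F w).
Proof.
move=> aF i j w Uw; apply: (@analytic_at_ext (fun w => k * F w i j)).
  by move=> x; rewrite mxE.
by apply: analytic_atM; [exact: analytic_at_const|exact: aF].
Qed.

(** Transposing, extracting blocks and reshaping only rename entries. *)
Lemma mx_analytic_entries U m n m' n' (F : 'cV[R]_p -> 'M[R]_(m, n))
    (G : 'M[R]_(m, n) -> 'M[R]_(m', n')) :
  (forall i j, exists i' j', forall A, G A i j = A i' j') ->
  mx_analytic_on U F -> mx_analytic_on U (fun w => G (F w)).
Proof.
move=> GE aF i j w Uw; have [i' [j' Gij]] := GE i j.
apply: (@analytic_at_ext (fun w => F w i' j')); first by move=> x; rewrite Gij.
exact: aF.
Qed.

Lemma mx_analytic_tr U m n (F : 'cV[R]_p -> 'M[R]_(m, n)) :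
  mx_analytic_on U F -> mx_analytic_on U (fun w => (F w)^T).
Proof. by apply: mx_analytic_entries => i j; exists j, i => A; rewrite mxE. Qed.

Lemma mx_analytic_usub U m1 m2 n (F : 'cV[R]_p -> 'M[R]_(m1 + m2, n)) :
  mx_analytic_on U F -> mx_analytic_on U (fun w => usubmx (F w)).
Proof. by apply: mx_analytic_entries => i j; exists (lshift m2 i), j => A; rewrite mxE. Qed.

Lemma mx_analytic_dsub U m1 m2 n (F : 'cV[R]_p -> 'M[R]_(m1 + m2, n)) :
  mx_analytic_on U F -> mx_analytic_on U (fun w => dsubmx (F w)).
Proof. by apply: mx_analytic_entries => i j; exists (rshift m1 i), j => A; rewrite mxE. Qed.

Lemma mx_analytic_of_col U m n (F : 'cV[R]_p -> 'cV[R]_(m * n)) :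
  mx_analytic_on U F -> mx_analytic_on U (fun w => mx_of_col (F w)).
Proof.
apply: mx_analytic_entries => i j; exists (mxvec_index i j), 0 => A.
by rewrite /mx_of_col !mxE.
Qed.

Lemma mx_analytic_split_cols U d n (F : 'cV[R]_p -> 'cV[R]_(n * d)) :
  mx_analytic_on U F -> mx_analytic_on U (fun w => split_cols (F w)).
Proof.
apply: mx_analytic_entries => i j; exists (mxvec_index j i), 0 => A.
by rewrite /split_cols !mxE.
Qed.

Lemma mx_analytic_concat_cols U d n (F : 'cV[R]_p -> 'M[R]_(d, n)) :
  mx_analytic_on U F -> mx_analytic_on U (fun w => concat_cols (F w)).
Proof.
apply: mx_analytic_entries => k j; case/mxvec_indexP: k => i k.
by exists k, i => A; rewrite /concat_cols (ord1 j) mxE mxvecE mxE.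
Qed.

Lemma mx_analytic_softmax U m n (F : 'cV[R]_p -> 'M[R]_(m, n)) :
  mx_analytic_on U F -> mx_analytic_on U (fun w => softmax_rows (F w)).
Proof.
move=> aF i j w Uw.
have aE k : analytic_at (fun w => expR (F w i k)) w.
  apply: (@analytic_at_comp1 _ _ (fun w => F w i k)); first exact: aF.
  exact: analytic1_at_expR.
apply: (@analytic_at_ext (fun w => expR (F w i j) * (\sum_k expR (F w i k))^-1)).
  by move=> x; rewrite mxE.
apply: analytic_atM => //.
apply: (@analytic_at_comp1 _ _ (fun w => \sum_k expR (F w i k)) GRing.inv).
  by apply: analytic_at_sum => k _; exact: aE.
apply: analytic1_at_inv; rewrite gt_eqF// (bigD1 j)//= ltr_pwDl ?expR_gt0//.
by apply: sumr_ge0 => k _; exact: expR_ge0.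
Qed.

Lemma mx_analytic_attention U d n (Q K W : 'cV[R]_p -> 'M[R]_(d, n)) :
  mx_analytic_on U Q -> mx_analytic_on U K -> mx_analytic_on U W ->
  mx_analytic_on U (fun w => attention (Q w) (K w) (W w)).
Proof.
move=> aQ aK aW; apply: mx_analytic_mul => //; apply: mx_analytic_softmax.
by apply: mx_analytic_scale; apply: mx_analytic_mul => //; exact: mx_analytic_tr.
Qed.

(** The parameters of a layer are some of the [p] coordinates of a larger space,
    designated by [sel]; this spares all associativity casts. *)
Definition select q (sel : 'I_q -> 'I_p) (w : 'cV[R]_p) : 'cV[R]_q :=
  \col_j w (sel j) 0.

Lemma mx_analytic_select U q (sel : 'I_q -> 'I_p) : mx_analytic_on U (select sel).
Proof.
move=> i j w _; apply: (@analytic_at_ext (fun w => w (sel i) 0)).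
  by move=> x; rewrite mxE.
exact: analytic_at_coord.
Qed.

Lemma select_shift q (sel : 'I_q -> 'I_p) w t j : injective sel ->
  select sel (w + t *: coord_vec (sel j)) = select sel w + t *: coord_vec j.
Proof.
move=> injs; apply/matrixP => i k; rewrite !mxE (inj_eq injs) (ord1 k).
by [].
Qed.

Lemma select_shift_out q (sel : 'I_q -> 'I_p) w t j : (forall i, sel i != j) ->
  select sel (w + t *: coord_vec j) = select sel w.
Proof.
move=> selj; apply/matrixP => i k; rewrite !mxE (negbTE (selj i)).
by rewrite mulr0 addr0.
Qed.

End AnalyticMatrices.

Section Layers.
Context {R : realType}.

Lemma usubmx_shift_rshift m n (A : 'cV[R]_(m + n)) t (i : 'I_n) :
  usubmx (A + t *: coord_vec (rshift m i)) = usubmx A.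
Proof.
apply/matrixP => j k; rewrite !mxE eq_lrshift /=.
by rewrite mulr0 addr0.
Qed.

Lemma dsubmx_shift_rshift m n (A : 'cV[R]_(m + n)) t (i : 'I_n) :
  dsubmx (A + t *: coord_vec (rshift m i)) i 0 = dsubmx A i 0 + t.
Proof. by rewrite !mxE !eqxx mulr1. Qed.

(** The breakpoints of a piecewise analytic function tend to both infinities, so
    every point is a breakpoint or lies between two consecutive ones. *)
Lemma piecewise_analytic_cover (s : R -> R) : piecewise_analytic s ->
  exists (x : int -> R) (V : set R), [/\ open V, forall t, V t -> analytic1_at s t &
    forall t, ~ V t -> exists k, t = x k].
Proof.
move=> [x [xinc xp xm xa]]; exists x, (\bigcup_k `]x k, x (k + 1)[%classic); split.
- by apply: bigcup_open => k _; exact: interval_open.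
- by move=> t [k _ /=]; rewrite in_itv; exact: xa.
move=> t Vt.
have [M xM] : exists M : nat, x (- M%:Z) < t.
  move/cvgrNyPlt: xm => /(_ t)[M _ /(_ M (leqnn _)) xM]; by exists M.
have tN : exists N : nat, t < x (- M%:Z + N%:Z).
  move/cvgryPgt: xp => /(_ t)[N _ /(_ N (leqnn _)) tN]; exists (M + N)%N.
  by rewrite PoszD addKr.
case: (ex_minnP tN) => -[|N] tN1 minN.
  by move: tN1; rewrite addr0 ltNge ltW.
pose k := - M%:Z + N%:Z; exists k; apply/eqP; rewrite eq_le; apply/andP; split.
  rewrite leNgt; apply/negP => kt; apply: Vt; exists k => //=.
  by rewrite in_itv /= kt -[k + 1]addrA -PoszD addn1.
rewrite leNgt; apply/negP => tk; have := minN N tk.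
by rewrite ltnn.
Qed.

(** Biases make the breakpoints harmless: the preactivation of the neuron [i]
    has slope one in its own bias, so each breakpoint is attained on a null
    level set. *)
Lemma affine_ae_analytic p m n (U : set 'cV[R]_p) (W : 'cV[R]_p -> 'M[R]_(m, n))
    (b : 'cV[R]_p -> 'cV[R]_m) (z : 'cV[R]_p -> 'cV[R]_n) (s : R -> R)
    (v : 'I_m -> 'cV[R]_p) :
  piecewise_analytic s -> open U -> measure_zero (~` U) ->
  mx_analytic_on U W -> mx_analytic_on U b -> mx_analytic_on U z ->
  (forall i w t, W (w + t *: v i) = W w) ->
  (forall i w t, b (w + t *: v i) i 0 = b w i 0 + t) ->
  (forall i w t, z (w + t *: v i) = z w) ->
  exists U', [/\ open U', measure_zero (~` U') &
    mx_analytic_on U' (fun w => affine s (W w) (b w) (z w))].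
Proof.
move=> /piecewise_analytic_cover[x [V [oV sV Vx]]] oU U0 aW ab az Wv bv zv.
pose g i w := (W w *m z w + b w) i 0.
have ag i : analytic_on U (g i).
  by move=> w Uw; apply: mx_analytic_add => //; exact: mx_analytic_mul.
have cg i w : U w -> {for w, continuous (g i)}.
  by move=> Uw; apply: analytic_at_continuous; exact: ag.
pose U' := \bigcap_(i in [set: 'I_m]) (U `&` g i @^-1` V) `&` U.
have gv i w t : g i (w + t *: v i) = g i w + t.
  by rewrite /g Wv zv !mxE bv addrA.
exists U'; split.
- apply: openI => //; apply: open_finite_bigcap => i.
  by apply: open_preimage => // w; exact: cg.
- apply: (@measure_zero_sub _ _ _ (~` U `|`
    \bigcup_(ik : 'I_m * int) (U `&` [set w | g ik.1 w = x ik.2]))).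
    move=> w U'w; have [Uw|] := pselect (U w); last by left.
    right; apply: contrapT => nw; apply: U'w; split=> // i _; split=> //=.
    by apply: contrapT => /Vx[k gk]; apply: nw; exists (i, k).
  apply: measure_zeroU => //; apply: measure_zero_bigcup => -[i k].
  by apply: (level_set_null (v := v i)) => //; exact: cg.
- move=> i j w [gw Uw]; apply: (@analytic_at_ext _ _ (s \o g i)).
    by move=> y; rewrite /g /affine (ord1 j) [RHS]mxE.
  apply: analytic_at_comp1; first exact: ag.
  by apply: sV; have [] := gw i I.
Qed.

Lemma layer_ae_analytic n m (L : layer R n m) p
    (sel : 'I_(layer_params L) -> 'I_p) (z : 'cV[R]_p -> 'cV[R]_n) (U : set 'cV[R]_p) :
  layer_activation piecewise_analytic L -> injective sel ->
  open U -> measure_zero (~` U) -> mx_analytic_on U z ->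
  (forall w t j, z (w + t *: coord_vec (sel j)) = z w) ->
  exists U', [/\ open U', measure_zero (~` U') &
    mx_analytic_on U' (fun w => layer_eval (L := L) (select sel w) (z w))].
Proof.
case: L sel z => [{}n {}m s|{}n {}m k tie surj s|{}n d d'] /= sel z sP injs oU U0 az zinv.
- apply: (@affine_ae_analytic _ _ _ U _ _ _ s
    (fun i => coord_vec (sel (rshift (m * n) i)))) => //.
  + exact/mx_analytic_of_col/mx_analytic_usub/mx_analytic_select.
  + exact/mx_analytic_dsub/mx_analytic_select.
  + by move=> i w t; rewrite select_shift// usubmx_shift_rshift.
  + by move=> i w t; rewrite select_shift// dsubmx_shift_rshift.
- apply: (@affine_ae_analytic _ _ _ U _ _ _ s
    (fun i => coord_vec (sel (rshift k i)))) => //.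
  + apply: (@mx_analytic_entries _ _ _ _ _ _ _ (fun w => usubmx (select sel w))
      (fun A => \matrix_(i, j) A (tie (i, j)) 0)).
      by move=> i j; exists (tie (i, j)), 0 => A; rewrite mxE.
    exact/mx_analytic_usub/mx_analytic_select.
  + exact/mx_analytic_dsub/mx_analytic_select.
  + by move=> i w t; rewrite select_shift// usubmx_shift_rshift.
  + by move=> i w t; rewrite select_shift// dsubmx_shift_rshift.
- exists U; split=> //; apply: mx_analytic_concat_cols.
  have aX := mx_analytic_split_cols az.
  have aS := @mx_analytic_select _ _ U _ sel.
  apply: mx_analytic_attention; apply: mx_analytic_mul => //;
    apply: mx_analytic_of_col.
  + exact: mx_analytic_usub.
  + exact/mx_analytic_usub/mx_analytic_dsub.
  + exact/mx_analytic_dsub/mx_analytic_dsub.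
Qed.

(** Later layers are fed by a function [z] of the parameters that does not depend
    on their own parameters; this independence is what the induction carries. *)
Lemma network_ae_analytic n m (N : network R n m) p
    (sel : 'I_(network_params N) -> 'I_p) (z : 'cV[R]_p -> 'cV[R]_n) (U : set 'cV[R]_p) :
  network_activations piecewise_analytic N -> injective sel ->
  open U -> measure_zero (~` U) -> mx_analytic_on U z ->
  (forall w t j, z (w + t *: coord_vec (sel j)) = z w) ->
  exists U', [/\ open U', measure_zero (~` U') &
    mx_analytic_on U' (fun w => network_eval (N := N) (select sel w) (z w))].
Proof.
elim: N sel z U => [{}n {}m L|{}n {}m q L N IH] /= sel z U.
  exact: layer_ae_analytic.
move=> [LP NP] injs oU U0 az zinv.
pose sel1 j := sel (lshift (network_params N) j).
pose sel2 j := sel (rshift (layer_params L) j).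
have inj1 : injective sel1 by move=> i j /injs /lshift_inj.
have inj2 : injective sel2 by move=> i j /injs /rshift_inj.
have u1 w : usubmx (select sel w) = select sel1 w by apply/matrixP => i j; rewrite !mxE.
have d2 w : dsubmx (select sel w) = select sel2 w by apply/matrixP => i j; rewrite !mxE.
have [U1 [oU1 U10 az1]] := layer_ae_analytic LP inj1 oU U0 az (fun w t j => zinv w t _).
have [|U2 [oU2 U20 az2]] := IH sel2 _ U1 NP inj2 oU1 U10 az1.
  move=> w t j; rewrite zinv select_shift_out// => i.
  by rewrite (inj_eq injs) eq_lrshift.
exists U2; split=> //; move: az2; congr mx_analytic_on.
by apply/funext => w; rewrite u1 d2.
Qed.

(** With all the parameters selected, the fed function is the constant input;
    finitely many inputs leave an open set with null complement. *)
Lemma batch_loss_ae_analytic n0 nD (N : network R n0 nD) m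
    (x : 'I_m -> 'cV[R]_n0) (y : 'I_m -> 'cV[R]_nD)
    (l : 'cV[R]_nD -> 'cV[R]_nD -> R) (I : {set 'I_m}) :
  network_activations piecewise_analytic N -> analytic2 l ->
  measure_zero (~` analytic_domain (batch_loss (N := N) x y l I)).
Proof.
move=> NP al.
have /choice[U UP] : forall i, exists U, [/\ open U, measure_zero (~` U) &
    mx_analytic_on U (fun w => network_eval (N := N) w (x i))].
  move=> i.
  have [|||||U [oU U0 aU]] := @network_ae_analytic _ _ N _ id (fun=> x i) setT NP.
  - by move=> ? ?.
  - exact: openT.
  - by rewrite setCT; exact: measure_zero0.
  - by move=> j k w _; exact: analytic_at_const.
  - by [].
  exists U; split=> //; move: aU; congr mx_analytic_on.
  by apply/funext => w; congr network_eval; apply/matrixP => j k; rewrite mxE (ord1 k).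
pose V := \bigcap_(i in [set: 'I_m]) U i.
have V0 : measure_zero (~` V).
  apply: (@measure_zero_sub _ _ _ (\bigcup_i ~` U i)).
    by rewrite setC_bigcap.
  by apply: measure_zero_bigcup => i; case: (UP i).
apply: measure_zero_sub V0; apply: subsetC; apply: analytic_domain_max.
  by apply: open_finite_bigcap => i; case: (UP i).
move=> w Vw; apply: analytic_atM; first exact: analytic_at_const.
apply: analytic_at_sum => i _.
apply: (@analytic_at_ext _ _ ((fun v : 'cV[R]_(nD + nD) => l (usubmx v) (dsubmx v)) \o
   (fun w => col_mx (y i) (network_eval (N := N) w (x i))))).
  by move=> v /=; rewrite col_mxKu col_mxKd.
apply: analytic_at_comp; last exact: al.
move=> j; case: (split_ordP j) => k ->.
  apply: (@analytic_at_ext _ _ (fun=> y i k 0)) (analytic_at_const _ _).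
  by move=> v; rewrite col_mxEu.
apply: (@analytic_at_ext _ _ (fun w => network_eval (N := N) w (x i) k 0)).
  by move=> v; rewrite col_mxEd.
by have [_ _ aU] := UP i; apply: aU; exact: Vw.
Qed.

End Layers.

(** * Gradient descent *)

Lemma countable_negligible (R : realType) (A : set R) :
  countable A -> (@lebesgue_measure R).-negligible A.
Proof.
move=> cA; exists A; split=> //; last exact: countable_lebesgue_measure0.
by apply: countable_measurable => // t; exact: measurable_set1.
Qed.

Section GradientDescent.
Context {R : realType} {p : nat}.
Context (f : 'cV[R]_p -> R).
Local Notation mu := (@lebesgue_outer_measure R p).

Definition partial (i : 'I_p) (x : 'cV[R]_p) : R := 'D_(coord_vec i) f x.

Definition hessian (x : 'cV[R]_p) : 'M[R]_p :=
  \matrix_(i, j) 'D_(coord_vec j) (partial i) x.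

(** The points where the derivative of [theta - eta * gradient f theta] is
    singular. *)
Definition degenerate (eta : R) : set 'cV[R]_p :=
  analytic_domain f `&` [set x | \det (1%:M - eta *: hessian x) = 0].

Lemma partial_analytic i x : analytic_domain f x -> analytic_at (partial i) x.
Proof. by move=> fx; apply: analytic_at_derive; exact: analytic_domain_on fx. Qed.

Lemma det_hessian_continuous eta x : analytic_domain f x ->
  {for x, continuous (fun x => \det (1%:M - eta *: hessian x))}.
Proof.
move=> fx; apply: analytic_at_continuous.
have aE i j : analytic_at (fun x => (1%:M - eta *: hessian x) i j) x.
  apply: (@analytic_at_ext _ _
    (fun x => (i == j)%:R + - eta * 'D_(coord_vec j) (partial i) x)).
    by move=> y; rewrite !mxE mulNr.
  apply: analytic_atD; first exact: analytic_at_const.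
  apply: analytic_atM; first exact: analytic_at_const.
  by apply: analytic_at_derive; exact: partial_analytic.
apply: analytic_at_sum => s _; apply: analytic_atM; first exact: analytic_at_const.
elim: (index_enum _) => [|i r IH].
  by under eq_fun do rewrite big_nil; exact: analytic_at_const.
by under eq_fun do rewrite big_cons; exact: analytic_atM.
Qed.

Lemma finite_poly_roots (P : {poly R}) : P != 0 -> finite_set [set t | root P t].
Proof.
move=> P0; apply: contrapT => /infiniteP/ppcard_leP[g].
pose s := [seq (g i : R) | i <- iota 0 (size P)].
have us : uniq s by rewrite map_inj_uniq ?iota_uniq.
have rs : all (root P) s.
  by apply/allP => _ /mapP[i _ ->]; exact: (@funS _ _ _ _ g i I).
by have := max_poly_roots P0 rs us; rewrite size_map size_iota ltnn.
Qed.

(** The determinant is a polynomial in [eta], equal to [1] at [0]. *)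
Lemma degenerate_finite x : finite_set [set eta | degenerate eta x].
Proof.
pose M : 'M[{poly R}]_p := 1%:M - 'X *: map_mx polyC (hessian x).
have ME eta : (\det M).[eta] = \det (1%:M - eta *: hessian x).
  rewrite -[LHS]/(horner_eval eta (\det M)) -det_map_mx; congr (\det _).
  apply/matrixP => i j; rewrite /M !mxE -[LHS]/(_.[eta]) hornerD hornerN hornerM.
  by rewrite hornerX hornerC -polyC_natr hornerC.
apply: (@sub_finite_set _ _ [set t | root (\det M) t]).
  by move=> eta [_ /= d0]; rewrite rootE ME d0.
apply: finite_poly_roots; apply/eqP => M0; have := ME 0.
rewrite M0 horner0 scale0r subr0 det1 => /esym/eqP.
by rewrite oner_eq0.
Qed.

Lemma countable_degenerate : countable [set eta | ~ measure_zero (degenerate eta)].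
Proof.
apply: countable_positive_measure degenerate_finite => eta.
apply: caratheodory_level; first exact: analytic_domain_open.
by move=> x; exact: det_hessian_continuous.
Qed.

Lemma mulmx_norm_le (M : 'M[R]_p) : exists2 C : R, 0 < C &
  forall v : 'cV[R]_p, `|M *m v| <= C * `|v|.
Proof.
pose C : R := 1 + \sum_i \sum_j `|M i j|.
have S0 (i : 'I_p) : 0 <= \sum_j `|M i j| by apply: sumr_ge0.
have C0 : 0 < C by rewrite ltr_pwDl// sumr_ge0.
exists C => // v; apply: norm_le_coord => [|i]; first by rewrite mulr_ge0// ltW.
rewrite mxE; apply: le_trans (ler_norm_sum _ _ _) _.
apply: (@le_trans _ _ ((\sum_j `|M i j|) * `|v|)).
  rewrite mulr_suml; apply: ler_sum => j _.
  by rewrite normrM ler_wpM2l// coord_le_norm.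
rewrite ler_wpM2r// /C [X in 1 + X](bigD1 i)//= addrCA lerDl addr_ge0//.
by apply: sumr_ge0.
Qed.

(** Near a nondegenerate point the gradient descent map is expanding up to a
    constant, by strict differentiability of the gradient. *)
Lemma gradient_descent_expanding eta G x : 0 < eta -> gradient_descent_map f eta G ->
  analytic_domain f x -> \det (1%:M - eta *: hessian x) != 0 ->
  exists2 V, nbhs x V & exists2 C : R, 0 < C &
    forall y z, V y -> V z -> `|y - z| <= C * `|G y - G z|.
Proof.
move=> eta0 GE fx dx; set A := 1%:M - _ in dx.
have uA : A \in unitmx by rewrite unitmxE unitfE.
have [C C0 CP] := mulmx_norm_le (invmx A).
pose e := (2 * C)^-1; have e0 : 0 < e by rewrite invr_gt0 mulr_gt0.
have /choice[d dP] : forall i, exists d, 0 < d /\ forall y z,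
    `|y - x| <= d -> `|z - x| <= d ->
    `|partial i y - partial i z - \sum_j hessian x i j * (y j 0 - z j 0)|
      <= e / eta * `|y - z|.
  move=> i; have [d d0 dP] := analytic_at_strict (partial_analytic i fx) (divr_gt0 e0 eta0).
  exists d; split=> // y z yd zd; apply: le_trans (dP y z yd zd).
  by under eq_bigr do rewrite mxE.
pose V := [set y | analytic_domain f y /\ forall i, `|y - x| <= d i].
exists V.
  apply: filterI; first by apply: open_nbhs_nbhs; split=> //; exact: analytic_domain_open.
  apply: (@filter_forall _ _ (fun i y => `|y - x| <= d i) _ (nbhs_filter x)) => i.
  apply/nbhs_ballP; exists (d i); first by case: (dP i).
  by move=> y; rewrite -ball_normE /= distrC => /ltW.
exists (2 * C); first by rewrite mulr_gt0.
move=> y z [fy yd] [fz zd].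
have close : `|A *m (y - z) - (G y - G z)| <= e * `|y - z|.
  apply: norm_le_coord => [|i]; first by rewrite mulr_ge0// ltW.
  rewrite (GE y fy) (GE z fz).
  have -> : (A *m (y - z) - (y - eta *: gradient f y - (z - eta *: gradient f z))) i 0
      = eta * (partial i y - partial i z - \sum_j hessian x i j * (y j 0 - z j 0)).
    rewrite mulmxBl mul1mx -scalemxAl !mxE.
    have -> : \sum_j hessian x i j * (y - z) j 0 = \sum_j hessian x i j * (y j 0 - z j 0).
      by apply: eq_bigr => j _; rewrite !mxE.
    rewrite /partial /coord_vec; ring.
  rewrite normrM gtr0_norm//.
  apply: le_trans (ler_wpM2l (ltW eta0) ((dP i).2 y z (yd i) (zd i))) _.
  by rewrite mulrA mulrCA divff ?gt_eqF// mulr1.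
have : `|y - z| <= C * (`|G y - G z| + e * `|y - z|).
  rewrite -{1}[y - z](mulKmx uA); apply: le_trans (CP _) _.
  rewrite ler_wpM2l ?(ltW C0)//.
  rewrite -[A *m _](subrK (G y - G z)) (le_trans (ler_normD _ _))// addrC lerD2l.
  exact: close.
have -> : C * (`|G y - G z| + e * `|y - z|) = C * `|G y - G z| + `|y - z| / 2.
  by rewrite mulrDr /e; congr (_ + _); field; rewrite gt_eqF.
lra.
Qed.

(** A null set is pulled back to a null set near each nondegenerate point of the
    analytic domain; countably many rational boxes collect these
    neighbourhoods. *)
Lemma gradient_descent_non_singular eta G : 0 < eta -> gradient_descent_map f eta G ->
  measure_zero (~` analytic_domain f) -> measure_zero (degenerate eta) ->
  non_singular G.
Proof.
move=> eta0 GE D0 Z0 B B0.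
pose good q := `[< measure_zero (rational_box q `&` G @^-1` B) >].
apply: (@measure_zero_sub _ _ _ ((~` analytic_domain f `|` degenerate eta) `|`
  \bigcup_(q : 'cV[rat]_p * nat) if good q then rational_box q `&` G @^-1` B else set0)).
  move=> x Bx; have [fx|] := pselect (analytic_domain f x); last by left; left.
  have [dx|dx] := eqVneq (\det (1%:M - eta *: hessian x)) 0; first by left; right.
  right; have [V xV [C C0 CP]] := gradient_descent_expanding eta0 GE fx dx.
  have [q [qx qV]] := rational_box_sub xV; exists q => //.
  rewrite /good; case: asboolP => [_|[]]; first by split.
  apply: (@measure_zero_sub _ _ _ (V `&` G @^-1` B)).
    by move=> y [qy By]; split=> //; exact: qV.
  exact: (null_preimage_expanding C0 CP).
apply: measure_zeroU; first exact: measure_zeroU.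
apply: measure_zero_bigcup => q; rewrite /good; case: asboolP => // _.
exact: measure_zero0.
Qed.

End GradientDescent.

Theorem theorem1 (R : realType) (n0 nD : nat) (N : network R n0 nD)
    (m : nat) (x : 'I_m -> 'cV[R]_n0) (y : 'I_m -> 'cV[R]_nD)
    (l : 'cV[R]_nD -> 'cV[R]_nD -> R) :
  network_activations piecewise_analytic N ->
  analytic2 l ->
  {ae lebesgue_measure, forall eta : R, 0 < eta ->
    forall I : {set 'I_m}, I != finset.set0 ->
    forall G : 'cV[R]_(network_params N) -> 'cV[R]_(network_params N),
      gradient_descent_map (batch_loss x y l I) eta G -> non_singular G}.
Proof.
move=> NP al.
pose E (I : {set 'I_m}) := [set eta : R |
  ~ measure_zero (degenerate (batch_loss (N := N) x y l I) eta)].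
have cE : countable (\bigcup_I E I).
  apply: bigcup_countable => [|I _]; first exact: countableP.
  exact: countable_degenerate.
apply: (negligibleS _ (countable_negligible cE)) => eta /= bad.
apply: contrapT => good; apply: bad => eta0 I _ G GE.
apply: (gradient_descent_non_singular eta0 GE).
  exact: batch_loss_ae_analytic.
by apply: contrapT => Z0; apply: good; exists I.
Qed.
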